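(* Let $N\ge1$ be an integer. Assume \[ \mathcal V_N(a_n^{-1}:n\ge0)+\mathcal V_N(a_n^{-1}b_n:n\ge0)+\mathcal V_N(a_n^{-1}a_{n-1}^*:n\ge1)<\infty . \] Let (a) $\lim_{n\to\infty}\|a_n^{-1}-T_n\|=0$, (b) $\lim_{n\to\infty}\|a_n^{-1}b_n-Q_n\|=0$, (c) $\lim_{n\to\infty}\|a_n^{-1}a_{n-1}^*-R_n\|=0$, (d) $\lim_{n\to\infty}\left\|\frac{a_n}{\|a_n\|}-C_n\right\|=0$ for $N$-periodic sequences $(T_n:n\ge0)$, $(Q_n:n\ge0)$, $(R_n:n\ge0)$, $(C_n:n\ge0)$ of bounded operators on $\mathcal H$, with every $C_n$ invertible. Let $\Lambda$ be the set of $\lambda\in\mathbb R$ such that \[ \mathcal F(\lambda)=\mathrm{Re}\left[\begin{pmatrix}0&-C_{N-1}\\ C_{N-1}^*&0\end{pmatrix}\prod_{i=0}^{N-1}\begin{pmatrix}0&\mathrm{Id}\\ -R_i&\lambda T_i-Q_i\end{pmatrix}\right] \] is a strictly positive or a strictly negative operator on $\mathcal H\oplus\mathcal H$. Then for every compact set $K\subset\Lambda$ there are positive constants $c_1,c_2$ such that for every generalised eigenvector $u$ associated with $\lambda\in K$ and every $n\ge1$ \[ c_1(\|u_0\|^2+\|u_1\|^2)\le\|a_n\|(\|u_{n-1}\|^2+\|u_n\|^2)\le c_2(\|u_0\|^2+\|u_1\|^2). \]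
   Context: Let $\mathcal H$ be a complex Hilbert space, and let $(a_n:n\ge 0)$, $(b_n:n\ge 0)$ be sequences of bounded linear operators on $\mathcal H$ such that every $a_n$ has a bounded inverse and every $b_n$ is self-adjoint. $\|\cdot\|$ on operators is the operator norm. For $z\in\mathbb C$, a generalised eigenvector associated with $z$ is a non-zero sequence $u=(u_n:n\ge0)$ in $\mathcal H$ with $a_{n-1}^*u_{n-1}+b_nu_n+a_nu_{n+1}=zu_n$ for all $n\ge1$. The total $N$-variation of a sequence $(x_n:n\ge n_0)$ in a normed space is $\mathcal V_N(x_n:n\ge n_0)=\sum_{n=n_0}^\infty\|x_{n+N}-x_n\|$. Products of operators are ordered with larger indices to the left: $\prod_{k=n_0}^{n_1}X_k=X_{n_1}X_{n_1-1}\cdots X_{n_0}$. For a bounded operator $X$, $\mathrm{Re}[X]=\frac12(X+X^* )$. A bounded self-adjoint operator $X$ is strictly positive if $X\ge c\,\mathrm{Id}$ for some $c>0$, and strictly negative if $-X$ is strictly positive. *)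

(* Defs.v *)
From HB Require Import structures.
From mathcomp Require Import all_boot all_order all_algebra.
From mathcomp Require Import complex.
From mathcomp Require Import all_classical all_reals all_analysis.

Set Implicit Arguments.
Unset Strict Implicit.
Unset Printing Implicit Defensive.

Import Order.TTheory GRing.Theory Num.Theory.
Import numFieldNormedType.Exports.
Local Open Scope classical_set_scope.
Local Open Scope complex_scope.
Local Open Scope ring_scope.

HB.mixin Record CompleteNormedModule_isHilbert (R : realType) H
    & CompleteNormedModule R[i] H := {
  dot : {dot H for @Num.conj R[i]} ;
  dotxx : forall x : H, dot x x = `|x| ^+ 2 }.

#[short(type="hilbertType")]
HB.structure Definition Hilbert (R : realType) :=
  {H of CompleteNormedModule R[i] H & CompleteNormedModule_isHilbert R H}.

(* The Hilbert direct sum: an alias of H * H, since the product of normed     *)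
(* modules of the library carries the max norm.                               *)
Definition dsum (R : realType) (H : hilbertType R) : Type := (H * H)%type.

Section dsum.
Variables (R : realType) (H : hilbertType R).

HB.instance Definition _ := GRing.Lmodule.copy (dsum H) (H * H)%type.

Definition dsum_norm (x : dsum H) : R[i] :=
  sqrtC (`|x.1| ^+ 2 + `|x.2| ^+ 2).

Lemma dsum_norm_ge0 x : 0 <= dsum_norm x.
Proof. by rewrite sqrtC_ge0 addr_ge0 ?exprn_ge0. Qed.

Lemma dsum_normD x y : dsum_norm (x + y) <= dsum_norm x + dsum_norm y.
Proof.
case: x y => [x1 x2] [y1 y2]; rewrite /dsum_norm /=.
have E (s t : R[i]) : 0 <= s -> 0 <= t ->
    sqrtC (s ^+ 2 + t ^+ 2) = `|s + 'i * t|.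
  by move=> s0 t0; rewrite normC_rect ?ger0_real.
rewrite !E //; apply: (@le_trans _ _ `|(`|x1| + `|y1|) + 'i * (`|x2| + `|y2|)|).
  rewrite -!E ?addr_ge0 // ler_sqrtC ?nnegrE ?addr_ge0 ?exprn_ge0 ?addr_ge0 //.
  by rewrite lerD // lerXn2r ?nnegrE ?addr_ge0 ?ler_normD.
by rewrite mulrDr addrACA ler_normD.
Qed.

Lemma dsum_normZ l x : dsum_norm (l *: x) = `|l| * dsum_norm x.
Proof.
by rewrite /dsum_norm /= !normrZ !exprMn -mulrDr sqrtCM ?sqrCK ?nnegrE ?exprn_ge0 //.
Qed.

Lemma dsum_norm0_eq0 x : dsum_norm x = 0 -> x = 0.
Proof.
case: x => x1 x2 /eqP; rewrite sqrtC_eq0 paddr_eq0 ?exprn_ge0 //=.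
by rewrite !expf_eq0 /= !normr_eq0 => /andP[/eqP -> /eqP ->].
Qed.

Lemma dsum_norm_fst x : `|x.1| <= dsum_norm x.
Proof.
rewrite -[leLHS]sqrCK ?normr_ge0 // ler_sqrtC ?nnegrE ?exprn_ge0 //.
by rewrite lerDl exprn_ge0.
Qed.

Lemma dsum_norm_snd x : `|x.2| <= dsum_norm x.
Proof.
rewrite -[leLHS]sqrCK ?normr_ge0 // ler_sqrtC ?nnegrE ?exprn_ge0 //.
by rewrite lerDr exprn_ge0.
Qed.

Lemma dsum_norm_le x : dsum_norm x <= `|x.1| + `|x.2|.
Proof.
rewrite -[leRHS]sqrCK ?addr_ge0 // ler_sqrtC ?nnegrE ?exprn_ge0 ?addr_ge0 ?exprn_ge0 //.
by rewrite sqrrD addrAC lerDl mulrn_wge0 // mulr_ge0.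
Qed.

HB.instance Definition _ := @Lmodule_isNormed.Build R[i] (dsum H)
  dsum_norm dsum_normD dsum_normZ dsum_norm0_eq0.

Lemma dsum_normE (x : dsum H) : `|x| = sqrtC (`|x.1| ^+ 2 + `|x.2| ^+ 2).
Proof. by []. Qed.

Lemma dsum_complete (F : set_system (dsum H)) :
  ProperFilter F -> cauchy F -> cvg F.
Proof.
move=> FF /cauchy_ballP Fc.
have cvg1 : cvg (fst @ F).
  apply: cauchy_cvg; apply/cauchy_ballP => e e0.
  rewrite near_map2; apply: filterS (Fc e e0) => -[x y] /=.
  rewrite -!ball_normE /ball_ /=; apply: le_lt_trans.
  exact: (dsum_norm_fst (x - y)).
have cvg2 : cvg (snd @ F).
  apply: cauchy_cvg; apply/cauchy_ballP => e e0.
  rewrite near_map2; apply: filterS (Fc e e0) => -[x y] /=.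
  rewrite -!ball_normE /ball_ /=; apply: le_lt_trans.
  exact: (dsum_norm_snd (x - y)).
apply/cvg_ex; exists ((lim (fst @ F), lim (snd @ F)) : dsum H).
apply/cvgrPdist_lt => e e0; near=> x.
apply: (le_lt_trans (dsum_norm_le _)) => /=; rewrite (splitr e) ltrD//.
  by near: x; move/cvgrPdist_lt : cvg1; apply; rewrite divr_gt0.
by near: x; move/cvgrPdist_lt : cvg2; apply; rewrite divr_gt0.
Unshelve. all: by end_near. Qed.

HB.instance Definition _ := Uniform_isComplete.Build (dsum H) dsum_complete.

Definition dsum_dot (x y : dsum H) : R[i] := dot x.1 y.1 + dot x.2 y.2.

Lemma dsum_dotBl y : zmod_morphism (dsum_dot ^~ y).
Proof. by move=> u v; rewrite /dsum_dot /= !linearBl addrACA opprD. Qed.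

Lemma dsum_dotBr x : zmod_morphism (dsum_dot x).
Proof. by move=> u v; rewrite /dsum_dot /= !raddfB addrACA opprD. Qed.

Lemma dsum_dotZl y : scalable_for *%R (dsum_dot ^~ y).
Proof. by move=> l u; rewrite /dsum_dot /= !linearZl mulrDr. Qed.

Lemma dsum_dotZr x : scalable_for (@Num.conj R[i] \; *%R) (dsum_dot x).
Proof. by move=> l u; rewrite /dsum_dot /= !linearZ /= mulrDr. Qed.

HB.instance Definition _ := isBilinear.Build _ _ _ _ _ _ dsum_dot
  dsum_dotBl dsum_dotBr dsum_dotZl dsum_dotZr.

Lemma dsum_dotC x y :
  dsum_dot x y = (-1) ^+ false * @Num.conj R[i] (dsum_dot y x).
Proof.
rewrite expr0 mul1r /dsum_dot rmorphD /=.
rewrite (hermC _ x.1) (hermC _ x.2).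
by rewrite !expr0 !mul1r.
Qed.

HB.instance Definition _ := isHermitianSesquilinear.Build _ _ _ _ dsum_dot
  dsum_dotC.

Lemma dsum_dotE (x : dsum H) : dsum_dot x x = `|x| ^+ 2.
Proof. by rewrite dsum_normE sqrtCK /dsum_dot !dotxx. Qed.

Lemma dsum_dot_gt0 (x : dsum H) : x != 0 -> 0 < dsum_dot x x.
Proof. by move=> x0; rewrite dsum_dotE exprn_gt0 // normr_gt0. Qed.

HB.instance Definition _ := isDotProduct.Build _ _ dsum_dot dsum_dot_gt0.

HB.instance Definition _ := CompleteNormedModule_isHilbert.Build R (dsum H)
  dsum_dotE.

End dsum.

(* The norm of the library takes its values in R[i] (on the nonnegative real  *)
(* axis); hnorm is the same number in R.                                      *)
Definition hnorm (R : realType) (H : hilbertType R) (x : H) : R :=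
  complex.Re `|x|.

Section operators.
Variables (R : realType) (H : hilbertType R).
Implicit Types A B X : H -> H.

Definition bounded_operator A : Prop :=
  linear A /\ exists M : R, forall x, hnorm (A x) <= M * hnorm x.

Definition opnorm A : R := sup [set hnorm (A x) | x in [set x | hnorm x <= 1]].

Definition boundedly_invertible A : Prop :=
  exists B, [/\ bounded_operator B, cancel A B & cancel B A].

(* Meaningful for a bijective A. *)
Definition opinv A : H -> H :=
  xget (fun=> 0) [set B | cancel A B /\ cancel B A].

(* For a bounded operator A the adjoint exists by the Riesz representation    *)
(* theorem, and is unique.                                                    *)
Definition adjoint A : H -> H :=
  xget (fun=> 0) [set B | forall x y, dot (A x) y = dot x (B y)].

Lemma opinvE A B : cancel A B -> cancel B A -> opinv A = B.
Proof.
move=> AK BK; rewrite /opinv; case: xgetP => [B' -> [AK' _]|/(_ B)].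
  by apply/funext => y; rewrite -{1}(BK y) AK'.
by case.
Qed.

Lemma adjointE A B :
  (forall x y, dot (A x) y = dot x (B y)) -> adjoint A = B.
Proof.
move=> AB; rewrite /adjoint; case: xgetP => [B' -> AB'|/(_ B)/(_ AB)//].
apply/funext => y; apply/eqP; rewrite -subr_eq0 -normr_eq0 -sqrf_eq0 -dotxx.
by rewrite raddfB /= -AB' -AB subrr.
Qed.

Definition self_adjoint A : Prop := adjoint A = A.

Definition opRe X : H -> H := (2^-1 : R[i]) *: (X + adjoint X).

(* The order of R[i] is used: s <= t means that t - s is a nonnegative real.  *)
Definition strictly_positive X : Prop :=
  [/\ bounded_operator X, self_adjoint X &
      exists c : R, 0 < c /\ forall x, 0 <= dot ((X - (c%:C *: id)) x) x].

Definition strictly_negative X : Prop := strictly_positive (- X).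

(* \sum_{n >= n0} ||x_{n+N} - x_n||, as an extended real number.              *)
Definition operator_variation (N n0 : nat) (x : nat -> H -> H) : \bar R :=
  (\sum_(n0 <= n <oo) (opnorm (x (n + N)%N - x n))%:E)%E.

Definition block_op (A B C D : H -> H) (p : dsum H) : dsum H :=
  (A p.1 + B p.2, C p.1 + D p.2).

Definition generalised_eigenvector (a b : nat -> H -> H) (z : R[i])
    (u : nat -> H) : Prop :=
  (exists n, u n != 0) /\
  forall n, (1 <= n)%N ->
    adjoint (a n.-1) (u n.-1) + b n (u n) + a n (u n.+1) = z *: u n.

End operators.

(* X_(N - 1) \o ... \o X_1 \o X_0 *)
Definition ordered_prod (T : Type) (N : nat) (X : nat -> T -> T) : T -> T :=
  iteri N (fun i Y => X i \o Y) id.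

(* S stands for the family of operators usually written R_n, R being the      *)
(* field of real numbers here.                                                *)
Section limit_form.
Variables (R : realType) (H : hilbertType R) (N : nat).
Variables (T Q S C : nat -> H -> H).

Definition limit_transfer (lam : R) (i : nat) : dsum H -> dsum H :=
  block_op 0 id (- S i) (lam%:C *: T i - Q i).

Definition calF (lam : R) : dsum H -> dsum H :=
  opRe (block_op 0 (- C N.-1) (adjoint (C N.-1)) 0
        \o ordered_prod N (limit_transfer lam)).

Definition Lambda : set R :=
  [set lam | strictly_positive (calF lam) \/ strictly_negative (calF lam)].

End limit_form.

(* Main.v *)
Require Import Defs.
From mathcomp Require Import all_boot all_order all_algebra.
From mathcomp Require Import complex.
From mathcomp Require Import all_classical all_reals all_analysis.
From mathcomp Require Import ring lra.
Import Order.TTheory GRing.Theory Num.Theory.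
Import numFieldNormedType.Exports.
Local Open Scope classical_set_scope.
Local Open Scope complex_scope.
Local Open Scope ring_scope.

(** Write [v_n = (u_(n-1), u_n)], so that the recurrence reads
    [v_(n+1) = B_n v_n] for the transfer operator [B_n], and let
    [X_n = B_(n+N-1) ... B_n].  The proof follows the N-shifted Turan
    determinant
    [S_n = Re <u_(n+N-1), a_(n+N-1) u_n> - Re <a_(n+N-1) u_(n+N), u_(n-1)>],
    which is the real quadratic form at [v_n] of [X_n] followed by the block
    operator with off-diagonal entries [- a_(n+N-1)] and [a_(n+N-1)^*].  It is compared with the energy [z_n = ||a_n|| |v_n|^2].

    Slow variation ([turan_step], [turan_variation]).  Substituting the
    recurrence at [n + N] and using that [b_(n+N)] is self-adjoint cancels
    everything in [S_n - S_(n+1)] except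
    [Re <u_(n+N), a_(n+N) (B_(n+N) v_n - B_n v_n)_2>].  Hence
    [|S_(n+1) - S_n| <= d_n z_n] where [d_n] is, up to a constant, the n-th
    term of the three N-variations, a summable sequence.

    Coercivity ([coercive_near], [coercive_on_compact]).  Divided by
    [||a_(n+N-1)||], the form defining [S_n] tends, along the multiples of N,
    to the form of [calF lam].  On Lambda the latter is bounded below in
    absolute value, and the perturbation is uniform for lam near a given point,
    so by compactness [c z_n <= |S_n|] for all large multiples [n] of [N], with
    one [c] for all of K.  The sign of the form is allowed to depend on lam.

    Regularity of the coefficients ([recS_lower_of_coercive],
    [opnorm_ratio_up], [opnorm_ratio_down]).  Coercivity makes [X_n] bounded
    below for large multiples of [N]; since every single [B_n] is onto, each
    factor, and then each [a_n^-1 a_(n-1)^*], is bounded below.  Together with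
    the convergence of [a_n / ||a_n||] to invertible operators this shows that
    the ratios of consecutive norms [||a_n||], and of consecutive [|v_n|], lie
    between two positive constants.  Thus knowing [S_n ~ z_n] along the
    multiples of [N] is enough.

    Conclusion ([comparable_of_slow_variation]).  Along the multiples of [N],
    [S] changes by a summable relative amount, hence stays comparable with its
    value at a fixed large index, and so does [z]; the ratio bounds extend this
    to every index, down to [n = 1].

    Only real parts of scalar products enter, so all estimates are made in the
    underlying real inner product space.  That adjoints exist follows from the
    Riesz representation theorem ([riesz_real]). *)

Set Implicit Arguments.
Unset Strict Implicit.
Unset Printing Implicit Defensive.

(** * The underlying real inner product space *)

Definition rdot (R : realType) (H : hilbertType R) (x y : H) : R :=
  complex.Re (dot x y).

Section real_structure.
Variables (R : realType) (H : hilbertType R).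
Implicit Types (x y z : H) (r : R).

Lemma ReM_real r (w : R[i]) : complex.Re (r%:C * w) = r * complex.Re w.
Proof. by case: w => s t /=; rewrite mul0r subr0. Qed.

Lemma hnormE x : `|x| = (hnorm x)%:C.
Proof. by rewrite /hnorm RRe_real // ger0_real. Qed.

Lemma rdotC x y : rdot x y = rdot y x.
Proof.
rewrite /rdot (hermC _ x y) expr0 mul1r.
apply: (@complexI R); rewrite !complexRe; exact: Re_conj.
Qed.

Lemma rdotDl x y z : rdot (x + y) z = rdot x z + rdot y z.
Proof. by rewrite /rdot linearDl /= raddfD. Qed.

Lemma rdot0l x : rdot 0 x = 0.
Proof. by rewrite /rdot linear0l. Qed.

Lemma rdot0r x : rdot x 0 = 0.
Proof. by rewrite rdotC rdot0l. Qed.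

Lemma rdotNl x z : rdot (- x) z = - rdot x z.
Proof. by rewrite /rdot linearNl /= raddfN. Qed.

Lemma rdotBl x y z : rdot (x - y) z = rdot x z - rdot y z.
Proof. by rewrite rdotDl rdotNl. Qed.

Lemma rdotZl r x z : rdot (r%:C *: x) z = r * rdot x z.
Proof. by rewrite /rdot linearZl_LR /= ReM_real. Qed.

Lemma rdotDr x y z : rdot z (x + y) = rdot z x + rdot z y.
Proof. by rewrite ![rdot z _]rdotC rdotDl. Qed.

Lemma rdotNr x z : rdot z (- x) = - rdot z x.
Proof. by rewrite ![rdot z _]rdotC rdotNl. Qed.

Lemma rdotBr x y z : rdot z (x - y) = rdot z x - rdot z y.
Proof. by rewrite ![rdot z _]rdotC rdotBl. Qed.

Lemma rdotZr r x z : rdot z (r%:C *: x) = r * rdot z x.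
Proof. by rewrite ![rdot z _]rdotC rdotZl. Qed.

Lemma hnorm_ge0 x : 0 <= hnorm x.
Proof. by rewrite -ler0c -hnormE. Qed.

Lemma hnorm0 : hnorm (0 : H) = 0.
Proof. by rewrite /hnorm normr0. Qed.

Lemma hnorm_eq0 x : (hnorm x == 0) = (x == 0).
Proof. by rewrite -(normr_eq0 x) hnormE -(inj_eq (@complexI R)). Qed.

Lemma hnorm_gt0 x : (0 < hnorm x) = (x != 0).
Proof. by rewrite lt_neqAle hnorm_ge0 andbT eq_sym hnorm_eq0. Qed.

Lemma ler_hnormD x y : hnorm (x + y) <= hnorm x + hnorm y.
Proof. by rewrite -lecR rmorphD /= -!hnormE ler_normD. Qed.

Lemma hnorm_opp x : hnorm (- x) = hnorm x.
Proof. by rewrite /hnorm normrN. Qed.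

Lemma ler_hnormB x y : hnorm (x - y) <= hnorm x + hnorm y.
Proof. by rewrite -(hnorm_opp y) ler_hnormD. Qed.

Lemma hnorm_scale r x : hnorm (r%:C *: x) = `|r| * hnorm x.
Proof.
rewrite /hnorm normrZ hnormE.
have -> : `|r%:C| = `|r|%:C :> R[i].
  by rewrite normc_def /= expr0n addr0 sqrtr_sqr.
by rewrite ReM_real.
Qed.

Lemma rdotxx x : rdot x x = hnorm x ^+ 2.
Proof. by rewrite /rdot dotxx hnormE -rmorphXn. Qed.

Lemma hnorm_sqrD x y :
  hnorm (x + y) ^+ 2 = hnorm x ^+ 2 + 2 * rdot x y + hnorm y ^+ 2.
Proof. rewrite -!rdotxx rdotDl !rdotDr (rdotC y x); ring. Qed.

Lemma norm_le_of_sqr_le (s t : R) : 0 <= t -> s ^+ 2 <= t ^+ 2 -> `|s| <= t.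
Proof.
by move=> t0 st; rewrite -(@ler_pXn2r _ 2) ?nnegrE // real_normK ?num_real.
Qed.

Lemma rdot_le_norm x y : `|rdot x y| <= hnorm x * hnorm y.
Proof.
have [x0|x0] := eqVneq (hnorm x) 0.
  move/eqP: x0; rewrite hnorm_eq0 => /eqP ->.
  by rewrite rdot0l normr0 mulr_ge0 ?hnorm_ge0.
have {x0} x0 : 0 < hnorm x by rewrite lt_neqAle eq_sym x0 hnorm_ge0.
apply: norm_le_of_sqr_le; first by rewrite mulr_ge0 ?hnorm_ge0.
have := sqr_ge0 (hnorm (((- rdot x y)%:C *: x) + (hnorm x ^+ 2)%:C *: y)).
rewrite hnorm_sqrD rdotZl rdotZr !hnorm_scale !exprMn !real_normK ?num_real //.
set s := rdot x y; set t := hnorm x in x0 *; set w := hnorm y => h.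
have {}h : 0 <= t ^+ 2 * (t ^+ 2 * w ^+ 2 - s ^+ 2) by nra.
by move: h; rewrite pmulr_rge0 ?exprn_gt0 // subr_ge0.
Qed.

Lemma rdot_le x y : rdot x y <= hnorm x * hnorm y.
Proof. exact: le_trans (ler_norm _) (rdot_le_norm _ _). Qed.

Lemma rdot_inj x y : (forall z, rdot z x = rdot z y) -> x = y.
Proof.
move=> h; apply/eqP; rewrite -subr_eq0 -hnorm_eq0 -sqrf_eq0 -rdotxx.
by rewrite rdotBr !h subrr.
Qed.

End real_structure.

(** * Riesz representation *)

Section riesz.
Variables (R : realType) (H : hilbertType R).

(** Minimise [J x = |x|^2 - 2 g x].  Comparing a point at which [J] is within
    [e] of its infimum with the other points of a line through it shows that
    [|Re <x, h> - g h| <= sqrt e |h|] for all [h]; two such almost-minimisers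
    are therefore at distance at most [2 sqrt e], the filter that they generate
    is Cauchy, and its limit represents [g]. *)
Lemma riesz_real (g : H -> R) (M : R) :
  (forall x y, g (x + y) = g x + g y) ->
  (forall (r : R) x, g (r%:C *: x) = r * g x) ->
  (forall x, `|g x| <= M * hnorm x) ->
  exists w, forall x, rdot x w = g x.
Proof.
move=> gD gZ gM.
pose J x : R := hnorm x ^+ 2 - 2 * g x.
have JM x : - M ^+ 2 <= J x.
  have := gM x; rewrite ler_norml => /andP[_]; rewrite /J => h.
  have := sqr_ge0 (hnorm x - M); nra.
have Jinf : has_inf (range J).
  split; first by exists (J 0), 0.
  by exists (- M ^+ 2) => _ [x _ <-].
pose m := inf (range J).
have mJ x : m <= J x by apply: ge_inf; [exact: Jinf.2 | exists x].
have near_min x e h : J x <= m + e -> (rdot x h - g h) ^+ 2 <= e * hnorm h ^+ 2.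
  move=> Jx; have [->|h0] := eqVneq h 0.
    have g0 : g 0 = 0 by have := gD 0 0; rewrite addr0 => ?; lra.
    by rewrite rdot0r hnorm0 g0 subrr expr0n mulr0.
  have k0 : 0 < hnorm h ^+ 2 by rewrite exprn_gt0 // hnorm_gt0.
  (* the minimum of J on the line x + t h is attained at this t *)
  pose t := - (rdot x h - g h) / hnorm h ^+ 2.
  have := mJ (x + t%:C *: h).
  rewrite /J hnorm_sqrD gD gZ rdotZr hnorm_scale exprMn real_normK ?num_real // => h1.
  move: Jx; rewrite /J => h2.
  have tE : t * hnorm h ^+ 2 = - (rdot x h - g h) by rewrite /t mulfVK // gt_eqF.
  have h3 : t ^+ 2 * hnorm h ^+ 2 <= e.
    suff -> : t ^+ 2 * hnorm h ^+ 2 = - (t ^+ 2 * hnorm h ^+ 2 + 2 * t * (rdot x h - g h)) by lra.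
    by rewrite -[rdot x h - g h]opprK -tE; ring.
  by rewrite -sqrrN -tE exprMn [(hnorm h ^+ 2) ^+ 2]expr2 mulrA ler_wpM2r // ltW.
have close e x y : J x <= m + e -> J y <= m + e -> 0 <= e -> hnorm (x - y) ^+ 2 <= 4 * e.
  move=> Jx Jy e0.
  have [->|xy0] := eqVneq (x - y) 0; first by rewrite hnorm0 expr0n mulr_ge0.
  have k0 : 0 < hnorm (x - y) by rewrite hnorm_gt0.
  have := near_min x e (x - y) Jx; have := near_min y e (x - y) Jy.
  have := rdotxx (x - y); rewrite rdotBl.
  set s := rdot x _; set t := rdot y _; set k := hnorm _ in k0 *; set c := g _.
  move=> st h1 h2.
  have h3 : (s - t) ^+ 2 <= 4 * e * k ^+ 2 by have := sqr_ge0 ((s - c) + (t - c)); nra.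
  by move: h3; rewrite st expr2 ler_pM2r // exprn_gt0.
pose F := filter_from [set e : R | 0 < e] (fun e => [set x | J x <= m + e]).
have FF : Filter F.
  apply: filter_from_filter; first by exists 1 => /=.
  move=> i j i0 j0; exists (Num.min i j) => /=; first by rewrite lt_min i0 j0.
  move=> x /= Jx; split => /=; apply: (le_trans Jx); rewrite lerD2l.
    by rewrite ge_min lexx.
  by rewrite ge_min lexx orbT.
have PF : ProperFilter F.
  apply: filter_from_proper => e /= e0.
  have [_ [x _ <-] Jx] := inf_adherent e0 Jinf.
  by exists x => /=; apply: ltW.
have Fx e : 0 < e -> F [set x | J x <= m + e] by move=> e0; exists e.
have cF : cvg F.
  apply: cauchy_cvg; apply/cauchy_exP => e e0.
  have eE : e = (complex.Re e)%:C by rewrite RRe_real // gtr0_real.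
  have {}e0 : 0 < complex.Re e by rewrite -ltcR -eE.
  set r := complex.Re e in eE e0.
  have d0 : 0 < r ^+ 2 / 16 by rewrite divr_gt0 ?exprn_gt0.
  have [x Jx] := filter_ex (Fx _ d0).
  exists x; apply: filterS (Fx _ d0) => y Jy.
  rewrite -ball_normE /ball_ /= hnormE eE ltcR.
  have := close _ _ _ Jx Jy (ltW d0) => h.
  rewrite -(@ltr_pXn2r _ 2) ?nnegrE ?hnorm_ge0 ?(ltW e0) //; nra.
exists (lim F) => x; apply/eqP; rewrite -subr_eq0 -normr_le0.
apply/ler_addgt0Pl => e e0; rewrite addr0.
have k0 : 0 < hnorm x + 1 by rewrite ltr_wpDl ?hnorm_ge0.
pose d := e / 2 / (hnorm x + 1).
have d0 : 0 < d by rewrite !divr_gt0.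
have /cvgrPdist_lt /(_ d%:C) : id @ F --> lim F by exact: cF.
rewrite ltcR => /(_ d0) /= Fl.
have [y [/= yl Jy]] := filter_ex (filterI Fl (Fx _ (exprn_gt0 2 d0))).
move: yl; rewrite hnormE ltcR => yl.
have h1 : `|rdot y x - g x| <= d * hnorm x.
  apply: norm_le_of_sqr_le; first by rewrite mulr_ge0 ?hnorm_ge0 ?ltW.
  by rewrite exprMn near_min.
have h2 : `|rdot x (lim F - y)| <= hnorm x * d.
  by apply: le_trans (rdot_le_norm _ _) _; rewrite ler_wpM2l ?hnorm_ge0 // ltW.
have -> : rdot x (lim F) - g x = rdot x (lim F - y) + (rdot y x - g x).
  by rewrite rdotBr (rdotC y) addrA subrK.
apply: le_trans (ler_normD _ _) _.
have dE : d * (hnorm x + 1) = e / 2 by rewrite /d mulfVK // gt_eqF.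
lra.
Qed.
End riesz.

(** * Bounded operators, adjoints and inverses *)

Section operator_theory.
Variables (R : realType) (H : hilbertType R).
Implicit Types (A B X : H -> H) (x y : H) (r M : R).

Lemma op_add A : linear A -> forall x y, A (x + y) = A x + A y.
Proof. by move=> lA x y; rewrite -[x in LHS]scale1r lA scale1r. Qed.

Lemma op_zero A : linear A -> A 0 = 0.
Proof. by move=> lA; apply: (addrI (A 0)); rewrite -op_add // !addr0. Qed.

Lemma op_scale A : linear A -> forall (c : R[i]) x, A (c *: x) = c *: A x.
Proof. by move=> lA c x; rewrite -[c *: x]addr0 lA op_zero // addr0. Qed.

Lemma op_opp A : linear A -> forall x, A (- x) = - A x.
Proof. by move=> lA x; rewrite -scaleN1r op_scale // scaleN1r. Qed.

Lemma op_sub A : linear A -> forall x y, A (x - y) = A x - A y.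
Proof. by move=> lA x y; rewrite op_add // -scaleN1r op_scale // scaleN1r. Qed.

(** The real functional [x |-> Re <A x, y>] is represented by Riesz; the
    imaginary parts of the two sides then agree because both are complex
    linear in [x]. *)
Lemma adjointP A : bounded_operator A ->
  forall x y, dot (A x) y = dot x (adjoint A y).
Proof.
move=> [lA [M AM]].
have Aex y : exists w, forall x, dot (A x) y = dot x w.
  have [||x|w wE] := @riesz_real _ _ (fun x => rdot (A x) y) (M * hnorm y).
  - by move=> x x'; rewrite op_add // rdotDl.
  - by move=> r x; rewrite op_scale // rdotZl.
  - apply: le_trans (rdot_le_norm _ _) _.
    by rewrite mulrAC ler_wpM2r ?hnorm_ge0.
  exists w => x; apply/eqP; rewrite eq_complex; apply/andP; split; apply/eqP.
    by have := wE x.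
  have := wE ('i%C *: x); rewrite op_scale // /rdot !linearZl_LR /=.
  case: (dot x w) => ? ? /=; case: (dot (A x) y) => ? ? /=.
  by rewrite !mul0r !mul1r !sub0r => /oppr_inj.
rewrite /adjoint; case: xgetP => [B -> //|noB].
pose B y := projT1 (cid (Aex y)).
by case: (noB B) => x y; rewrite /B; case: cid.
Qed.

Lemma rdot_adjoint A : bounded_operator A ->
  forall x y, rdot (A x) y = rdot x (adjoint A y).
Proof. by move=> bA x y; rewrite /rdot adjointP. Qed.

Lemma opnorm_le A M : 0 <= M -> (forall x, hnorm (A x) <= M * hnorm x) ->
  opnorm A <= M.
Proof.
move=> M0 AM; apply: ge_sup.
  by exists (hnorm (A 0)), 0 => //=; rewrite hnorm0.
move=> _ [x /= x1 <-]; apply: le_trans (AM x) _.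
by rewrite -[leRHS]mulr1 ler_wpM2l.
Qed.

Lemma opnorm_ub A x : bounded_operator A -> hnorm x <= 1 ->
  hnorm (A x) <= opnorm A.
Proof.
move=> [_ [M AM]] x1; apply: ub_le_sup; last by exists x.
exists `|M| => _ [y /= y1 <-]; apply: le_trans (AM y) _.
apply: le_trans (ler_wpM2r (hnorm_ge0 _) (ler_norm M)) _.
by rewrite -[leRHS]mulr1 ler_wpM2l.
Qed.

Lemma opnorm_ge0 A : bounded_operator A -> 0 <= opnorm A.
Proof.
move=> bA; apply: le_trans (hnorm_ge0 (A 0)) _.
by apply: opnorm_ub => //; rewrite hnorm0.
Qed.

Lemma le_opnorm A x : bounded_operator A -> hnorm (A x) <= opnorm A * hnorm x.
Proof.
move=> bA; have [->|x0] := eqVneq x 0.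
  by rewrite (op_zero bA.1) !hnorm0 mulr0.
have k0 : 0 < hnorm x by rewrite hnorm_gt0.
have := @opnorm_ub A ((hnorm x)^-1%:C *: x) bA.
rewrite (op_scale bA.1) !hnorm_scale ger0_norm ?invr_ge0 ?hnorm_ge0 //.
rewrite mulVf ?gt_eqF // => /(_ (lexx _)).
by rewrite mulrC ler_pdivrMr.
Qed.

Lemma bounded_operatorD A B : bounded_operator A -> bounded_operator B ->
  bounded_operator (A + B).
Proof.
move=> bA bB; split.
  move=> c x y.
  rewrite -![(A + B) _]/(A _ + B _) bA.1 bB.1 scalerDr !addrA; congr (_ + _).
  by rewrite addrAC.
exists (opnorm A + opnorm B) => x; apply: le_trans (ler_hnormD (A x) (B x)) _.
by rewrite mulrDl lerD // le_opnorm.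
Qed.

Lemma bounded_operatorZ (c : R) A : bounded_operator A ->
  bounded_operator (c%:C *: A).
Proof.
move=> bA; split.
  move=> d x y; rewrite -![(c%:C *: A) _]/(c%:C *: A _) bA.1 scalerDr.
  by rewrite !scalerA mulrC.
exists (`|c| * opnorm A) => x.
by rewrite -[(c%:C *: A) _]/(c%:C *: A _) hnorm_scale -mulrA ler_wpM2l // le_opnorm.
Qed.

Lemma bounded_operatorN A : bounded_operator A -> bounded_operator (- A).
Proof.
by move=> /(bounded_operatorZ (-1)); rewrite rmorphN scaleN1r.
Qed.

Lemma bounded_operatorB A B : bounded_operator A -> bounded_operator B ->
  bounded_operator (A - B).
Proof. by move=> bA bB; apply/bounded_operatorD/bounded_operatorN. Qed.

Lemma bounded_operator_comp A B : bounded_operator A -> bounded_operator B ->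
  bounded_operator (A \o B).
Proof.
move=> bA bB; split; first by move=> c x y /=; rewrite bB.1 bA.1.
exists (opnorm A * opnorm B) => x; have := le_opnorm (B x) bA. move=> h; apply: (le_trans h).
by rewrite -mulrA ler_wpM2l ?opnorm_ge0 // le_opnorm.
Qed.

Lemma bounded_operator_id : bounded_operator (id : H -> H).
Proof. by split => //; exists 1 => x; rewrite mul1r. Qed.

Lemma bounded_operator0 : bounded_operator (0 : H -> H).
Proof.
split; first by move=> c x y; rewrite -![(0 : H -> H) _]/(0 : H) scaler0 addr0.
by exists 0 => x; rewrite mul0r hnorm0.
Qed.

Lemma hnorm_adjoint_le A y : bounded_operator A ->
  hnorm (adjoint A y) <= opnorm A * hnorm y.
Proof.
move=> bA; have [->|y0] := eqVneq (hnorm (adjoint A y)) 0.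
  by rewrite mulr_ge0 ?opnorm_ge0 ?hnorm_ge0.
have k0 : 0 < hnorm (adjoint A y) by rewrite lt_neqAle eq_sym y0 hnorm_ge0.
rewrite -(ler_pM2l k0) -expr2 -rdotxx -rdot_adjoint //.
apply: le_trans (rdot_le _ _) _.
by rewrite mulrCA mulrA ler_wpM2r ?hnorm_ge0 // le_opnorm.
Qed.

Lemma bounded_adjoint A : bounded_operator A -> bounded_operator (adjoint A).
Proof.
move=> bA; split; last by exists (opnorm A) => y; apply: hnorm_adjoint_le.
move=> c x y; apply/eqP; rewrite -subr_eq0 -normr_eq0 -sqrf_eq0 -dotxx.
set w := _ - _.
rewrite {2}/w linearBr /= linearDr /= linearZr_LR /= -!adjointP //.
by rewrite linearDr /= linearZr_LR subrr.
Qed.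

Lemma adjointK A : bounded_operator A -> adjoint (adjoint A) = A.
Proof.
move=> bA; apply: adjointE => x y.
rewrite hermC [RHS]hermC !expr0 !mul1r; congr (Num.conj _); apply: esym; exact: adjointP.
Qed.

Lemma opinv_spec A : boundedly_invertible A ->
  [/\ bounded_operator (opinv A), cancel A (opinv A) & cancel (opinv A) A].
Proof. by move=> [B [bB AB BA]]; rewrite (opinvE AB BA). Qed.

Lemma adjoint_cancel A B : bounded_operator A -> bounded_operator B ->
  cancel A B -> cancel (adjoint B) (adjoint A).
Proof.
move=> bA bB AK x; apply: rdot_inj => z.
by rewrite -!rdot_adjoint // AK.
Qed.

End operator_theory.

(** * Hilbert direct sums and ordered products *)

Section direct_sum.
Variables (R : realType) (H : hilbertType R).
Implicit Types (p w v : dsum H) (A B : H -> H).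

Lemma hnorm_dsum p : hnorm p ^+ 2 = hnorm p.1 ^+ 2 + hnorm p.2 ^+ 2.
Proof. by rewrite -!rdotxx /rdot {1}/dot /= /dsum_dot raddfD. Qed.

Lemma hnorm_fst p : hnorm p.1 <= hnorm p.
Proof.
rewrite -(@ler_pXn2r _ 2) ?nnegrE ?hnorm_ge0 // hnorm_dsum lerDl.
by rewrite exprn_ge0 ?hnorm_ge0.
Qed.

Lemma hnorm_snd p : hnorm p.2 <= hnorm p.
Proof.
rewrite -(@ler_pXn2r _ 2) ?nnegrE ?hnorm_ge0 // hnorm_dsum lerDr.
by rewrite exprn_ge0 ?hnorm_ge0.
Qed.

Lemma hnorm_dsum_le p : hnorm p <= hnorm p.1 + hnorm p.2.
Proof.
rewrite -(@ler_pXn2r _ 2) ?nnegrE ?addr_ge0 ?hnorm_ge0 // hnorm_dsum.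
rewrite sqrrD addrAC lerDl mulrn_wge0 // mulr_ge0 ?hnorm_ge0 //.
Qed.

Lemma bounded_block_op (A B C D : H -> H) :
  bounded_operator A -> bounded_operator B ->
  bounded_operator C -> bounded_operator D -> bounded_operator (block_op A B C D).
Proof.
move=> bA bB bC bD; split.
  move=> c [x x'] [y y'].
  have E (X Y : H -> H) : linear X -> linear Y ->
    X (c *: x + y) + Y (c *: x' + y') = c *: (X x + Y x') + (X y + Y y').
    by move=> -> ->; rewrite scalerDr addrACA.
  by rewrite /block_op /= (E A B bA.1 bB.1) (E C D bC.1 bD.1).
exists (opnorm A + opnorm B + (opnorm C + opnorm D)) => p.
apply: le_trans (hnorm_dsum_le _) _; rewrite mulrDl.
have E (X Y : H -> H) : bounded_operator X -> bounded_operator Y ->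
  hnorm (X p.1 + Y p.2) <= (opnorm X + opnorm Y) * hnorm p.
  move=> bX bY; apply: le_trans (ler_hnormD _ _) _; rewrite mulrDl.
  rewrite lerD //; apply: le_trans (le_opnorm _ _) _ => //.
    by rewrite ler_wpM2l ?opnorm_ge0 ?hnorm_fst.
  by rewrite ler_wpM2l ?opnorm_ge0 ?hnorm_snd.
by rewrite lerD ?E.
Qed.

End direct_sum.

Section products.
Variables (R : realType) (H : hilbertType R).
Implicit Types (X Y : nat -> H -> H).

Lemma ordered_prodS (T : Type) n (X : nat -> T -> T) x :
  ordered_prod n.+1 X x = X n (ordered_prod n X x).
Proof. by []. Qed.

Lemma ordered_prodD (T : Type) m n (X : nat -> T -> T) x :
  ordered_prod (m + n) X x
  = ordered_prod n (fun i => X (m + i)%N) (ordered_prod m X x).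
Proof.
elim: n => [|n IHn]; first by rewrite addn0.
by rewrite addnS !ordered_prodS IHn.
Qed.

Lemma bounded_ordered_prod n X : (forall i, bounded_operator (X i)) ->
  bounded_operator (ordered_prod n X).
Proof.
move=> bX; elim: n => [|n IHn]; first exact: bounded_operator_id.
exact: (bounded_operator_comp (bX n) IHn).
Qed.

Lemma ordered_prod_le n X (M : R) : 0 <= M ->
  (forall i x, (i < n)%N -> hnorm (X i x) <= M * hnorm x) ->
  forall x, hnorm (ordered_prod n X x) <= M ^+ n * hnorm x.
Proof.
move=> M0; elim: n => [|n IHn] XM x; first by rewrite expr0 mul1r.
rewrite ordered_prodS exprS -mulrA; apply: le_trans (XM _ _ _) _ => //.
by rewrite ler_wpM2l // IHn // => i y /ltnW /XM.
Qed.

(** Telescoping: replacing one factor at a time costs [e], and all the other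
    factors have norm at most [M + 1]. *)
Lemma ordered_prod_perturb n X Y (M e : R) : 0 <= M -> 0 <= e <= 1 ->
  (forall i, linear (X i)) ->
  (forall i x, (i < n)%N -> hnorm (X i x) <= M * hnorm x) ->
  (forall i x, (i < n)%N -> hnorm (Y i x - X i x) <= e * hnorm x) ->
  forall x, hnorm (ordered_prod n Y x - ordered_prod n X x)
            <= e * n%:R * (M + 1) ^+ n * hnorm x.
Proof.
move=> M0 /andP[e0 e1] lX XM YX x.
have Y_le i y : (i < n)%N -> hnorm (Y i y) <= (M + 1) * hnorm y.
  move=> ni; rewrite -[Y i y](subrK (X i y)); apply: le_trans (ler_hnormD _ _) _.
  rewrite mulrDl addrC lerD ?XM // mul1r; apply: le_trans (YX _ _ ni) _.
  by rewrite ler_piMl ?hnorm_ge0.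
elim: n XM YX Y_le => [|n IHn] XM YX Y_le.
  by rewrite subrr hnorm0 mulr0 !mul0r.
rewrite !ordered_prodS.
set y := ordered_prod n Y x; set y' := ordered_prod n X x.
have -> : Y n y - X n y' = (Y n y - X n y) + X n (y - y').
  by rewrite op_sub // addrA subrK.
have h1 : hnorm y <= (M + 1) ^+ n * hnorm x.
  by apply: ordered_prod_le => [|i z /ltnW/Y_le]; rewrite ?addr_ge0.
have h2 : hnorm (y - y') <= e * n%:R * (M + 1) ^+ n * hnorm x.
  by apply: IHn => i z /ltnW ?; auto.
apply: le_trans (ler_hnormD _ _) _.
have h3 : hnorm (Y n y - X n y) <= e * ((M + 1) ^+ n * hnorm x).
  by apply: le_trans (YX _ _ _) _ => //; rewrite ler_wpM2l.
have h4 : hnorm (X n (y - y')) <= M * (e * n%:R * (M + 1) ^+ n * hnorm x).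
  by apply: le_trans (XM _ _ _) _ => //; rewrite ler_wpM2l.
apply: le_trans (lerD h3 h4) _.
rewrite exprS -natr1.
set P := (M + 1) ^+ n * hnorm x.
have P0 : 0 <= P by rewrite mulr_ge0 ?exprn_ge0 ?addr_ge0 ?hnorm_ge0.
have -> : M * (e * n%:R * (M + 1) ^+ n * hnorm x) = M * n%:R * (e * P) by rewrite /P; ring.
have -> : e * (n%:R + 1) * ((M + 1) * (M + 1) ^+ n) * hnorm x
  = (M * n%:R + M + n%:R + 1) * (e * P) by rewrite /P; ring.
rewrite -[leLHS]/(e * P + _) -{1}[e * P]mul1r -mulrDl ler_wpM2r ?(mulr_ge0 e0 P0) //.
have n0 : 0 <= n%:R :> R by [].
nra.
Qed.

(** A lower bound on a product passes to each factor, provided the factors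
    applied before it are onto: write [y] as their value at some [x] and bound
    the factors applied after it by [M].  In infinite dimension surjectivity
    cannot be dropped, as a shift composed with its left inverse shows. *)
Lemma ordered_prod_lower n X (M c : R) : 1 <= M ->
  (forall i x, (i < n)%N -> hnorm (X i x) <= M * hnorm x) ->
  (forall i y, (i < n)%N -> exists x, X i x = y) ->
  (forall x, c * hnorm x <= hnorm (ordered_prod n X x)) -> 0 <= c ->
  forall i y, (i < n)%N -> c * hnorm y <= M ^+ n * hnorm (X i y).
Proof.
move=> M1 XM Xsurj clow c0 i y ni.
have M0 : 0 <= M by apply: le_trans M1.
have [x xy] : exists x, ordered_prod i X x = y.
  elim: i ni y => [|i IHi] ni y; first by exists y.
  have [z zy] := Xsurj i y (ltnW ni); have [x xz] := IHi (ltnW ni) z.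
  by exists x; rewrite ordered_prodS xz.
have nE : n = (i + (1 + (n - i.+1)))%N by rewrite addnA addn1 subnKC.
have yx : hnorm y <= M ^+ i * hnorm x.
  by rewrite -xy; apply: ordered_prod_le => // j z ji; apply/XM/(ltn_trans ji).
have := clow x; rewrite nE ordered_prodD xy ordered_prodD /= => h.
have h1 : c * hnorm x <= M ^+ (n - i.+1) * hnorm (X i y).
  apply: le_trans h _; have := @ordered_prod_le (n - i.+1) (fun j => X (i + (1 + j))%N) M M0.
  rewrite addn0; apply => j z ji; apply: XM.
  by rewrite addnA addn1 -ltn_subRL.
apply: le_trans (ler_wpM2l c0 yx) _; rewrite mulrCA.
apply: le_trans (ler_wpM2l (exprn_ge0 _ M0) h1) _.
rewrite mulrA -exprD ler_wpM2r ?hnorm_ge0 // ler_weXn2l //.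
by rewrite leq_add2l leq_addl.
Qed.

End products.

(** * Sequences with summable relative increments *)

Section scalar_recursions.
Variable R : realType.
Implicit Types (d z S : nat -> R) (L c C e : R).

Lemma small_tail d (n0 : nat) (D e : R) : (forall n, 0 <= d n) ->
  (forall n, \sum_(n0 <= i < n) d i <= D) -> 0 < e ->
  exists m0, forall m n, (m0 <= m)%N -> \sum_(m <= i < n) d i <= e.
Proof.
move=> d0 dD e0.
pose s n := \sum_(n0 <= i < n) d i.
have sup_s : has_sup (range s).
  by split; [exists (s 0%N), 0%N | exists D => _ [n _ <-]; apply: dD].
have [_ [m1 _ <-] sm1] := sup_adherent e0 sup_s.
exists (maxn m1 n0) => m n; rewrite geq_max => /andP[m1m n0m].
have [nm|mn] := leqP n m; first by rewrite big_geq // ltW.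
have sn : s n <= sup (range s) by apply: ub_le_sup; [exact: sup_s.2 | exists n].
have sE : s n = s m + \sum_(m <= i < n) d i.
  by rewrite /s (big_cat_nat n0m (ltnW mn)).
have sm : s m1 <= s m.
  have [n0m1|m1n0] := leqP n0 m1.
    by rewrite /s (big_cat_nat n0m1 m1m) lerDl sumr_ge0.
  by rewrite {1}/s big_geq ?(ltnW m1n0) // sumr_ge0.
lra.
Qed.

Lemma ratio_iter z L m j : 0 <= L -> (forall n, (m <= n)%N -> z n.+1 <= L * z n) ->
  z (m + j)%N <= L ^+ j * z m.
Proof.
move=> L0 zL; elim: j => [|j IHj]; first by rewrite addn0 expr0 mul1r.
rewrite addnS exprS -mulrA; apply: le_trans (zL _ _) _; first exact: leq_addr.
by rewrite ler_wpM2l.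
Qed.

Lemma ratio_iter_rev z L m j : 0 <= L ->
  (forall n, (m <= n)%N -> z n <= L * z n.+1) -> z m <= L ^+ j * z (m + j)%N.
Proof.
move=> L0 zL; elim: j => [|j IHj]; first by rewrite addn0 expr0 mul1r.
apply: le_trans IHj _; rewrite addnS exprSr -mulrA ler_wpM2l ?exprn_ge0 //.
by rewrite zL // leq_addr.
Qed.

(** Along the multiples of [N] beyond a large index [m], [S] dominates [z], so
    the bound on the increments of [S] becomes a relative one, with sum at most
    [1/4] by the choice of [m]; hence [|S|] changes at most by a factor 2 after
    [m].  The ratio bound [L] reaches the indices between multiples of [N] and
    those below [m].  The constant [G] does not depend on [z] and [S]; this is
    what makes the estimate uniform in the eigenvector and in the spectral
    parameter. *)
Lemma comparable_of_slow_variation (N n0 : nat) L c C D d :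
  (0 < N)%N -> 1 <= L -> 0 < c -> c <= C -> (forall n, 0 <= d n) ->
  (forall n, \sum_(1 <= i < n) d i <= D) ->
  exists2 G, 0 < G & forall z S,
    (forall n, (1 <= n)%N -> 0 <= z n) ->
    (forall n, (1 <= n)%N -> z n.+1 <= L * z n) ->
    (forall n, (1 <= n)%N -> z n <= L * z n.+1) ->
    (forall n, (1 <= n)%N -> `|S n.+1 - S n| <= d n * z n) ->
    (forall k, (n0 <= k)%N -> c * z (k * N)%N <= `|S (k * N)%N| <= C * z (k * N)%N) ->
    forall n, (1 <= n)%N -> z n <= G * z 1%N /\ z 1%N <= G * z n.
Proof.
move=> N0 L1 c0 cC d0 dD.
have Lp : 0 < L by apply: lt_le_trans L1.
have L0 := ltW Lp.
have C0 : 0 < C by apply: lt_le_trans cC.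
have LN0 : 0 < L ^+ N by rewrite exprn_gt0.
have [m0 tail] := @small_tail d 1 D (c / (4 * L ^+ N)) d0 dD (divr_gt0 c0 (mulr_gt0 (ltr0n _ 4) LN0)).
(* positive, beyond n0, and with a small tail of d after k0 N *)
pose k0 := maxn 1 (maxn n0 m0).
have kN k : (k <= k * N)%N by rewrite leq_pmulr.
have k01 : (1 <= k0)%N by rewrite leq_maxl.
have k0m0 : (m0 <= k0)%N by rewrite /k0 !leq_max leqnn !orbT.
have k0n0 : (n0 <= k0)%N by rewrite /k0 !leq_max leqnn !orbT.
pose m := (k0 * N)%N.
have m1 : (1 <= m)%N by rewrite (leq_trans k01).
exists (L ^+ m * (2 * C / c) * L ^+ N).
  by rewrite !mulr_gt0 ?exprn_gt0 ?invr_gt0.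
move=> z S z0 zS zP SS Sz n n1.
have up p j : (1 <= p)%N -> z (p + j)%N <= L ^+ j * z p.
  by move=> p1; apply: ratio_iter => // i pi; apply/zS/(leq_trans p1).
have down p j : (1 <= p)%N -> z p <= L ^+ j * z (p + j)%N.
  by move=> p1; apply: ratio_iter_rev => // i pi; apply/zP/(leq_trans p1).
have Lmono p q : (p <= q)%N -> L ^+ p <= L ^+ q by move=> pq; rewrite ler_weXn2l.
pose sg k := S (k * N)%N.
(* t k bounds the total relative change of S between m and k N *)
pose t k := L ^+ N / c * \sum_(m <= i < k * N) d i.
have step k : (k0 <= k)%N -> `|sg k.+1 - sg k| <= (t k.+1 - t k) * `|sg k|.
  move=> k0k.
  have kN1 : (1 <= k * N)%N by rewrite (leq_trans k01) // (leq_trans k0k).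
  have -> : t k.+1 - t k = L ^+ N / c * \sum_(k * N <= i < k.+1 * N) d i.
    rewrite /t -mulrBr; congr (_ * _).
    rewrite (@big_cat_nat _ _ _ (k * N)%N) ?leq_mul //= addrAC subrr add0r //.
  rewrite /sg -(@telescope_sumr _ _ _ S) ?leq_mul //.
  apply: le_trans (ler_norm_sum _ _ _) _.
  rewrite [X in _ <= X * _]mulr_sumr mulr_suml; apply: ler_sum_nat => i /andP[ki ik].
  have i1 : (1 <= i)%N by apply: leq_trans ki.
  apply: le_trans (SS _ i1) _; rewrite [L ^+ N / c * _]mulrC -mulrA ler_wpM2l //.
  have /andP[h _] := Sz k (leq_trans k0n0 k0k).
  have h1 : z i <= L ^+ N * z (k * N)%N.
    rewrite -(subnKC ki); apply: le_trans (up _ _ kN1) _.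
    rewrite ler_wpM2r ?z0 // Lmono // leq_subLR.
    by move: ik; rewrite mulSn addnC => /ltnW.
  apply: le_trans h1 _; rewrite -mulrA ler_wpM2l ?(ltW LN0) //.
  by rewrite mulrC ler_pdivlMr // mulrC.
have t_small k : t k <= 4^-1.
  have := tail m (k * N)%N (leq_trans k0m0 (kN k0)).
  rewrite /t => h; apply: le_trans (ler_wpM2l _ h) _.
    by rewrite divr_ge0 ?ltW.
  rewrite le_eqVlt; apply/orP; left; apply/eqP; field.
  by rewrite !gt_eqF.
have t0 k : 0 <= t k by rewrite mulr_ge0 ?sumr_ge0 // divr_ge0 ?ltW.
have sgE j : `|sg (k0 + j)%N - sg k0| <= 2 * t (k0 + j)%N * `|sg k0|.
  elim: j => [|j IHj].
    by rewrite addn0 subrr normr0 mulr_ge0 ?normr_ge0 // mulr_ge0 ?t0.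
  have := step (k0 + j)%N (leq_addr _ _); rewrite addnS.
  set a := sg _.+1; set b := sg (k0 + j)%N in IHj *; set x := sg k0 in IHj *.
  have := t_small (k0 + j)%N; have := t0 (k0 + j)%N.
  set t1 := t _.+1; set tj := t (k0 + j)%N in IHj * => tj0 tj4 h.
  have tt : 0 <= t1 - tj.
    rewrite /t1 /tj /t -mulrBr; apply: mulr_ge0.
      by rewrite divr_ge0 ?ltW.
    rewrite subr_ge0.
    have mk : (m <= (k0 + j) * N)%N by rewrite leq_mul2r leq_addr orbT.
    by rewrite [leRHS](big_cat_nat mk) ?leq_mul //= ler_wpDr ?sumr_ge0.
  have h1 : `|b| <= 2 * `|x|.
    have -> : b = (b - x) + x by rewrite subrK.
    apply: le_trans (ler_normD _ _) _; have := normr_ge0 x; nra.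
  have -> : a - x = (a - b) + (b - x) by rewrite addrA subrK.
  apply: le_trans (ler_normD _ _) _; nra.
have bounds k : (k0 <= k)%N ->
    z (k * N)%N <= 2 * C / c * z m /\ z m <= 2 * C / c * z (k * N)%N.
  move=> k0k; have := sgE (k - k0)%N; rewrite subnKC // => h.
  have hk := t_small k; have hk0 := t0 k.
  have /andP[u1 u2] := Sz k (leq_trans k0n0 k0k).
  have /andP[v1 v2] := Sz k0 k0n0.
  rewrite -/(sg k) in u1 u2; rewrite -/(sg k0) -/m in v1 v2.
  have x0 := normr_ge0 (sg k0).
  have h1 : `|sg k - sg k0| <= 2^-1 * `|sg k0| by nra.
  have h2 : `|sg k| <= 2 * `|sg k0|.
    rewrite -[sg k](subrK (sg k0)); apply: le_trans (ler_normD _ _) _; lra.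
  have h3 : `|sg k0| <= 2 * `|sg k|.
    have := ler_normD (sg k) (sg k0 - sg k); rewrite addrC subrK distrC; lra.
  by split; rewrite mulrAC ler_pdivlMr //; lra.
have Lm1 : 1 <= L ^+ m by rewrite exprn_ege1.
have LN1 : 1 <= L ^+ N by rewrite exprn_ege1.
have Cc1 : 1 <= 2 * C / c by rewrite ler_pdivlMr //; lra.
have z10 := z0 1%N isT; have zn0 := z0 n n1.
have [nm|mn] := leqP n m.
  have h1 : z n <= L ^+ m * z 1%N.
    have := up 1%N n.-1 isT; rewrite add1n prednK // => /le_trans; apply.
    by rewrite ler_wpM2r // Lmono // (leq_trans (leq_pred _)).
  have h2 : z 1%N <= L ^+ m * z n.
    have := down 1%N n.-1 isT; rewrite add1n prednK // => /le_trans; apply.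
    by rewrite ler_wpM2r // Lmono // (leq_trans (leq_pred _)).
  have h3 : L ^+ m <= L ^+ m * (2 * C / c) * L ^+ N.
    rewrite -mulrA ler_peMr ?(le_trans _ Lm1) //.
    by rewrite mulr_ege1.
  split; [apply: le_trans h1 _ | apply: le_trans h2 _]; exact: ler_wpM2r.
have k0k : (k0 <= n %/ N)%N by rewrite leq_divRL // ltnW.
have [b1 b2] := bounds _ k0k.
have kN1 : (1 <= n %/ N * N)%N by rewrite (leq_trans k01) // (leq_trans k0k).
have nE := divn_eq n N.
have jN : (n %% N <= N)%N by rewrite ltnW // ltn_pmod.
have zk0 := z0 _ kN1; have zm0 := z0 _ m1.
have h1 : z n <= L ^+ N * z (n %/ N * N)%N.
  rewrite {1}nE; apply: le_trans (up _ _ kN1) _.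
  by rewrite ler_wpM2r // Lmono.
have h2 : z (n %/ N * N)%N <= L ^+ N * z n.
  rewrite {2}nE; apply: le_trans (down _ (n %% N)%N kN1) _.
  by rewrite ler_wpM2r ?Lmono // -nE.
have h3 : z m <= L ^+ m * z 1%N.
  have := up 1%N m.-1 isT; rewrite add1n prednK // => /le_trans; apply.
  by rewrite ler_wpM2r // Lmono // leq_pred.
have h4 : z 1%N <= L ^+ m * z m.
  have := down 1%N m.-1 isT; rewrite add1n prednK // => /le_trans; apply.
  by rewrite ler_wpM2r // Lmono // leq_pred.
have Cc0 : 0 <= 2 * C / c by apply: le_trans Cc1.
have Lm0 : 0 <= L ^+ m by apply: le_trans Lm1.
split.
  have -> : L ^+ m * (2 * C / c) * L ^+ N * z 1%N
    = L ^+ N * ((2 * C / c) * (L ^+ m * z 1%N)) by ring.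
  apply: (le_trans h1); rewrite ler_wpM2l ?(ltW LN0) //.
  by apply: (le_trans b1); rewrite ler_wpM2l.
apply: (le_trans h4); rewrite -!(mulrA (L ^+ m)) ler_wpM2l // -(mulrA (2 * C / c)).
by apply: (le_trans b2); rewrite ler_wpM2l.
Qed.

End scalar_recursions.

(** * The Turan form *)

Section turan_form.
Variables (R : realType) (H : hilbertType R).
Implicit Types (A B : H -> H) (w v : dsum H).

(** The real quadratic form of the block operator with zero diagonal and
    off-diagonal entries [- A] and [adjoint A] ([turan_form_block]), written so
    that it is manifestly linear in [A]. *)
Definition turan_form A w v : R := rdot w.1 (A v.2) - rdot (A w.2) v.1.

Lemma turan_form_block A w v : bounded_operator A ->
  rdot (block_op 0 (- A) (adjoint A) 0 w) v = turan_form A w v.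
Proof.
move=> bA; rewrite /turan_form (rdotC w.1) (rdot_adjoint bA v.2) (rdotC v.2).
rewrite {1}/rdot {1}/dot /= /dsum_dot raddfD /= -!/(rdot _ _).
rewrite -![(0 : H -> H) _]/(0 : H) add0r addr0 -[(- A) _]/(- A _) rdotNl.
by rewrite addrC.
Qed.

Lemma turan_form_le A w v : bounded_operator A ->
  `|turan_form A w v| <= 2 * opnorm A * hnorm w * hnorm v.
Proof.
move=> bA; apply: le_trans (ler_normB _ _) _.
have A0 := opnorm_ge0 bA.
have h1 : `|rdot w.1 (A v.2)| <= hnorm w * (opnorm A * hnorm v).
  apply: le_trans (rdot_le_norm _ _) _.
  rewrite ler_pM ?hnorm_ge0 ?hnorm_fst //; apply: le_trans (le_opnorm _ bA) _.
  by rewrite ler_wpM2l // hnorm_snd.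
have h2 : `|rdot (A w.2) v.1| <= (opnorm A * hnorm w) * hnorm v.
  apply: le_trans (rdot_le_norm _ _) _.
  rewrite ler_pM ?hnorm_ge0 ?hnorm_fst //; apply: le_trans (le_opnorm _ bA) _.
  by rewrite ler_wpM2l // hnorm_snd.
apply: le_trans (lerD h1 h2) _.
by rewrite le_eqVlt; apply/orP; left; apply/eqP; ring.
Qed.

Lemma turan_formBl A w w' v : bounded_operator A ->
  turan_form A (w - w') v = turan_form A w v - turan_form A w' v.
Proof.
move=> bA; rewrite /turan_form /= (op_sub bA.1) !rdotBl; ring.
Qed.

Lemma turan_formB A B w v :
  turan_form (A - B) w v = turan_form A w v - turan_form B w v.
Proof.
rewrite /turan_form -![(A - B) _]/(A _ - B _) rdotBr rdotBl; ring.
Qed.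

Lemma turan_formZ (r : R) A w v :
  turan_form (r%:C *: A) w v = r * turan_form A w v.
Proof.
rewrite /turan_form -![(r%:C *: A) _]/(r%:C *: A _) rdotZr rdotZl; ring.
Qed.

End turan_form.

Lemma limit_transferE (R : realType) (H : hilbertType R)
    (T Q S : nat -> H -> H) (lam : R) i (x : dsum H) :
  limit_transfer T Q S lam i x
  = (x.2, - S i x.1 + (lam%:C *: T i x.2 - Q i x.2)).
Proof.
by rewrite /limit_transfer /block_op -[(0 : H -> H) _]/(0 : H) add0r.
Qed.

(** * Transfer operators and their perturbation *)

Section transfer.
Variables (R : realType) (H : hilbertType R).
Variables T Q S T' Q' S' : nat -> H -> H.
Hypotheses (bT : forall n, bounded_operator (T n))
  (bQ : forall n, bounded_operator (Q n)) (bS : forall n, bounded_operator (S n))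
  (bT' : forall n, bounded_operator (T' n))
  (bQ' : forall n, bounded_operator (Q' n)) (bS' : forall n, bounded_operator (S' n)).
Implicit Types (lam : R) (x : dsum H).

Lemma bounded_limit_transfer lam i : bounded_operator (limit_transfer T Q S lam i).
Proof.
apply: bounded_block_op.
- exact: bounded_operator0.
- exact: bounded_operator_id.
- exact/bounded_operatorN.
- by apply/bounded_operatorB => //; apply/bounded_operatorZ.
Qed.

Lemma limit_transfer_le lam i x :
  hnorm (limit_transfer T Q S lam i x)
  <= (1 + opnorm (S i) + `|lam| * opnorm (T i) + opnorm (Q i)) * hnorm x.
Proof.
rewrite limit_transferE; apply: le_trans (hnorm_dsum_le _) _ => /=.
have [h1 h2] := (hnorm_fst x, hnorm_snd x).
have hT := le_opnorm x.2 (bT i); have hQ := le_opnorm x.2 (bQ i).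
have hS := le_opnorm x.1 (bS i).
have t0 := opnorm_ge0 (bT i); have q0 := opnorm_ge0 (bQ i).
have s0 := opnorm_ge0 (bS i).
have h3 := ler_hnormD (- S i x.1) (lam%:C *: T i x.2 - Q i x.2).
have h4 := ler_hnormB (lam%:C *: T i x.2) (Q i x.2).
rewrite hnorm_opp in h3; rewrite hnorm_scale in h4.
have h5 : `|lam| * hnorm (T i x.2) <= `|lam| * (opnorm (T i) * hnorm x).
  by rewrite ler_wpM2l // (le_trans hT) // ler_wpM2l.
have h6 : hnorm (Q i x.2) <= opnorm (Q i) * hnorm x.
  by rewrite (le_trans hQ) // ler_wpM2l.
have h7 : hnorm (S i x.1) <= opnorm (S i) * hnorm x.
  by rewrite (le_trans hS) // ler_wpM2l.
lra.
Qed.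

(** Used twice: against the periodic limits, where both lam and the
    coefficients move, and between the indices [n] and [n + N] of the same
    recurrence, where lam is fixed. *)
Lemma limit_transfer_diff lam lam' i i' x :
  hnorm (limit_transfer T Q S lam i x - limit_transfer T' Q' S' lam' i' x)
  <= (`|lam - lam'| * opnorm (T i) + `|lam'| * opnorm (T i - T' i')
      + opnorm (Q i - Q' i') + opnorm (S i - S' i')) * hnorm x.
Proof.
have -> : limit_transfer T Q S lam i x - limit_transfer T' Q' S' lam' i' x
  = (0, - (S i - S' i') x.1
        + ((lam - lam')%:C *: T i x.2
           + (lam'%:C *: (T i - T' i') x.2 - (Q i - Q' i') x.2))).
  rewrite !limit_transferE.
  rewrite -[LHS]/(x.2 - x.2, _ - _) subrr; congr (_, _).
  rewrite -[(S i - S' i') _]/(S i _ - S' i' _) -[(T i - T' i') _]/(T i _ - T' i' _).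
  rewrite -[(Q i - Q' i') _]/(Q i _ - Q' i' _).
  rewrite rmorphB /= scalerBl scalerBr !opprD !opprK.
  set s := S i _; set s' := S' i' _; set q := Q i _; set q' := Q' i' _.
  set t := lam%:C *: _; set u' := lam'%:C *: T' _ _; set u := lam'%:C *: _.
  by rewrite -(addrA u) subrKA addrACA; congr (_ + _); rewrite -addrA; congr (_ + _); exact: addrCA.
apply: le_trans (hnorm_dsum_le _) _ => /=; rewrite hnorm0 add0r.
have [h1 h2] := (hnorm_fst x, hnorm_snd x).
have bDT := bounded_operatorB (bT i) (bT' i').
have bDQ := bounded_operatorB (bQ i) (bQ' i').
have bDS := bounded_operatorB (bS i) (bS' i').
have hT := le_opnorm x.2 (bT i).
have hDT := le_opnorm x.2 bDT; have hQ := le_opnorm x.2 bDQ.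
have hS := le_opnorm x.1 bDS.
have t0 := opnorm_ge0 (bT i); have q0 := opnorm_ge0 bDQ.
have s0 := opnorm_ge0 bDS; have dt0 := opnorm_ge0 bDT.
set ds := (S i - S' i') in hS s0 *; set dq := (Q i - Q' i') in hQ q0 *.
set dt := (T i - T' i') in hDT dt0 *.
have h3 := ler_hnormD (- ds x.1) ((lam - lam')%:C *: T i x.2 + (lam'%:C *: dt x.2 - dq x.2)).
have h4 := ler_hnormD ((lam - lam')%:C *: T i x.2) (lam'%:C *: dt x.2 - dq x.2).
have h4' := ler_hnormB (lam'%:C *: dt x.2) (dq x.2).
rewrite hnorm_opp in h3; rewrite hnorm_scale in h4; rewrite hnorm_scale in h4'.
have h5 : `|lam - lam'| * hnorm (T i x.2) <= `|lam - lam'| * (opnorm (T i) * hnorm x).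
  by rewrite ler_wpM2l // (le_trans hT) // ler_wpM2l.
have h5' : `|lam'| * hnorm (dt x.2) <= `|lam'| * (opnorm dt * hnorm x).
  by rewrite ler_wpM2l // (le_trans hDT) // ler_wpM2l.
have h6 : hnorm (dq x.2) <= opnorm dq * hnorm x.
  by rewrite (le_trans hQ) // ler_wpM2l.
have h7 : hnorm (ds x.1) <= opnorm ds * hnorm x.
  by rewrite (le_trans hS) // ler_wpM2l.
lra.
Qed.

End transfer.

Section limit_form.
Variables (R : realType) (H : hilbertType R) (N : nat).
Variables T Q S C : nat -> H -> H.
Hypotheses (bT : forall n, bounded_operator (T n))
  (bQ : forall n, bounded_operator (Q n)) (bS : forall n, bounded_operator (S n))
  (bC : forall n, bounded_operator (C n)).

Lemma rdot_opRe (K : hilbertType R) (X : K -> K) x : bounded_operator X ->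
  rdot (opRe X x) x = rdot (X x) x.
Proof.
move=> bX; rewrite /opRe -[((2^-1 : R[i]) *: _) x]/((2^-1 : R[i]) *: (X x + adjoint X x)).
have -> : 2^-1 = (2^-1)%:C :> R[i] by rewrite fmorphV rmorph_nat.
rewrite rdotZl rdotDl (rdotC (adjoint X x)) -rdot_adjoint //.
by field.
Qed.

Lemma strictly_positive_coercive (K : hilbertType R) (X : K -> K) :
  strictly_positive X ->
  exists2 c, 0 < c & forall x, c * hnorm x ^+ 2 <= rdot (X x) x.
Proof.
move=> [_ _ [c [c0 Xc]]]; exists c => // x.
have := Xc x; rewrite lecE /= => /andP[_].
rewrite -/(rdot _ _) -[(X - _) x]/(X x - c%:C *: x) rdotBl rdotZl rdotxx.
by rewrite subr_ge0.
Qed.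

(** Taking absolute values treats the two signs allowed in [Lambda] at once. *)
Lemma Lambda_coercive lam : Lambda N T Q S C lam ->
  exists2 c, 0 < c & forall x, c * hnorm x ^+ 2
    <= `|turan_form (C N.-1) (ordered_prod N (limit_transfer T Q S lam) x) x|.
Proof.
have bX : bounded_operator (block_op 0 (- C N.-1) (adjoint (C N.-1)) 0
        \o ordered_prod N (limit_transfer T Q S lam)).
  apply: bounded_operator_comp.
    apply: bounded_block_op.
    - exact: bounded_operator0.
    - exact/bounded_operatorN.
    - exact/bounded_adjoint.
    - exact: bounded_operator0.
  apply: bounded_ordered_prod => i; exact: bounded_limit_transfer.
have E x : rdot (calF N T Q S C lam x) x
    = turan_form (C N.-1) (ordered_prod N (limit_transfer T Q S lam) x) x.
  by rewrite rdot_opRe // -turan_form_block.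
case=> /strictly_positive_coercive[c c0 Xc]; exists c => // x.
  by rewrite -E (le_trans (Xc x)) // ler_norm.
by rewrite -E -normrN (le_trans (Xc x)) // -rdotNl ler_norm.
Qed.

End limit_form.

(** * The three-term recurrence *)

Section jacobi.
Variables (R : realType) (H : hilbertType R) (a b : nat -> H -> H).

Definition recT n := opinv (a n).
Definition recQ n := opinv (a n) \o b n.
Definition recS n := opinv (a n) \o adjoint (a n.-1).

(** The transfer operator has the same shape as the limiting one, with the
    actual coefficients in place of their periodic limits. *)
Definition transfer lam := limit_transfer recT recQ recS lam.

Definition state (u : nat -> H) n : dsum H := (u n.-1, u n).

Hypotheses (ba : forall n, bounded_operator (a n))
  (bb : forall n, bounded_operator (b n))
  (ia : forall n, boundedly_invertible (a n)).

Lemma bounded_recT n : bounded_operator (recT n).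
Proof. by case: (opinv_spec (ia n)). Qed.

Lemma bounded_recQ n : bounded_operator (recQ n).
Proof. exact: bounded_operator_comp (bounded_recT n) (bb n). Qed.

Lemma bounded_recS n : bounded_operator (recS n).
Proof. exact: bounded_operator_comp (bounded_recT n) (bounded_adjoint (ba _)). Qed.

Lemma recTK n : cancel (recT n) (a n).
Proof. by case: (opinv_spec (ia n)). Qed.

Lemma recT_aK n : cancel (a n) (recT n).
Proof. by case: (opinv_spec (ia n)). Qed.

Lemma recS_inj n : exists X, [/\ bounded_operator X, cancel (recS n) X & cancel X (recS n)].
Proof.
exists (adjoint (recT n.-1) \o a n); split.
- exact: bounded_operator_comp (bounded_adjoint (bounded_recT _)) (ba n).
- move=> x /=; rewrite recTK; apply: adjoint_cancel => //; last exact: recTK.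
  exact: bounded_recT.
- move=> x; rewrite /recS /= (@adjoint_cancel _ _ (a n.-1) (recT n.-1)).
  + exact: recT_aK.
  + exact: ba.
  + exact: bounded_recT.
  + exact: recT_aK.
Qed.

Lemma transfer_surj lam n y : exists x, transfer lam n x = y.
Proof.
have [X [bX _ XK]] := recS_inj n.
exists (X ((lam%:C *: recT n y.1 - recQ n y.1) - y.2), y.1).
rewrite /transfer limit_transferE /= XK opprB subrK.
by case: y.
Qed.

(** The second component of the argument is the first component of the value,
    and the recurrence then determines [recS n x.1], which controls [x.1]. *)
Lemma transfer_lower (M K lam : R) n x : 0 <= M -> 0 <= K ->
  (forall y, hnorm (recT n y) <= M * hnorm y) ->
  (forall y, hnorm (recQ n y) <= M * hnorm y) ->
  (forall y, hnorm y <= M * hnorm (recS n y)) -> `|lam| <= K ->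
  hnorm x <= (1 + M * (1 + K * M + M)) * hnorm (transfer lam n x).
Proof.
move=> M0 K0 TM QM SM lamK.
set y := transfer lam n x.
have y1 : y.1 = x.2 by rewrite /y /transfer limit_transferE.
have y2 : recS n x.1 = (lam%:C *: recT n y.1 - recQ n y.1) - y.2.
  by rewrite y1 /y /transfer limit_transferE /= opprD opprK addrC subrK.
have [h1 h2] := (hnorm_fst y, hnorm_snd y).
apply: le_trans (hnorm_dsum_le _) _; rewrite -y1.
rewrite mulrDl mul1r addrC lerD //; apply: le_trans (SM _) _.
rewrite -mulrA ler_wpM2l // y2.
apply: le_trans (ler_hnormB _ _) _; rewrite -addrA mulrDl mul1r [leRHS]addrC lerD //.
apply: le_trans (ler_hnormB _ _) _; rewrite mulrDl hnorm_scale lerD //.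
  rewrite -mulrA ler_pM ?hnorm_ge0 //; apply: le_trans (TM _) _.
  exact: ler_wpM2l.
apply: le_trans (QM _) _; exact: ler_wpM2l.
Qed.

Hypothesis (sb : forall n, self_adjoint (b n)).
Variables (lam : R) (u : nat -> H).
Hypothesis ev : generalised_eigenvector a b lam%:C u.

Lemma state_recursion n : (1 <= n)%N -> state u n.+1 = transfer lam n (state u n).
Proof.
move=> n1; rewrite /transfer limit_transferE /state /=; congr (_, _).
have := ev.2 n n1 => /(canRL (addKr _)) h.
have lT := (bounded_recT n).1.
rewrite -[LHS](recT_aK n) h (op_add lT) (op_opp lT) (op_add lT) (op_scale lT).
rewrite opprD -addrA; congr (_ + _).
by rewrite addrC.
Qed.

Lemma state_iter n m : (1 <= n)%N ->
  state u (n + m)%N = ordered_prod m (fun i => transfer lam (n + i)%N) (state u n).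
Proof.
move=> n1; elim: m => [|m IHm]; first by rewrite addn0.
by rewrite ordered_prodS -IHm addnS state_recursion // (leq_trans n1) ?leq_addr.
Qed.

Definition turan N n :=
  turan_form (a (n + N).-1) (state u (n + N)) (state u n).

(** Pairing the recurrence at [n + N] with [u_n] eliminates [u_(n+N+1)]; by
    self-adjointness of [b_(n+N)] what remains is [u_(n+N)] paired with the
    amount by which the recurrence with the coefficients at [n + N] fails for
    [u_(n-1), u_n, u_(n+1)].  As the recurrence at [n] does hold for these three
    vectors, only the change of the coefficients over one period survives. *)
Lemma turan_step N n : (1 <= n)%N ->
  turan N n - turan N n.+1 = rdot (u (n + N)%N)
    (a (n + N)%N (transfer lam (n + N)%N (state u n) - transfer lam n (state u n)).2).
Proof.
move=> n1; set m := (n + N)%N.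
have m1 : (1 <= m)%N by rewrite (leq_trans n1) ?leq_addr.
rewrite -state_recursion // /transfer limit_transferE /turan addSn -/m /turan_form /=.
have := ev.2 m m1 => /(congr1 (fun x => rdot x (u n))).
rewrite !rdotDl rdotZl rdot_adjoint; last exact/bounded_adjoint.
rewrite adjointK // (@rdot_adjoint _ _ (b m)) // sb => E.
rewrite (op_sub (ba m).1) (op_add (ba m).1) (op_sub (ba m).1) (op_scale (ba m).1).
rewrite (op_opp (ba m).1) /recS /recT /recQ /= !recTK.
rewrite !rdotDr !rdotNr rdotZr -rdot_adjoint //.
lra.
Qed.

End jacobi.

(** * Uniform bounds for asymptotically periodic coefficients *)

Section uniformity.
Variables (R : realType).

Lemma uniform_of_eventual (P : nat -> R -> Prop) :
  (forall n M M', M <= M' -> P n M -> P n M') ->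
  (forall n, exists M, P n M) ->
  (exists M, \forall n \near \oo, P n M) ->
  exists2 M, 0 <= M & forall n, P n M.
Proof.
move=> Pmono Pex [M0 [n0 _ PM0]].
pose f n := projT1 (cid (Pex n)).
have fP n : P n (f n) by rewrite /f; case: cid.
exists (`|M0| + \sum_(i < n0) `|f i|); first by rewrite addr_ge0 ?sumr_ge0.
move=> n; have [nn0|n0n] := ltnP n n0.
  apply: Pmono (fP n); apply: le_trans (ler_norm _) _.
  by rewrite (bigD1 (Ordinal nn0)) //= addrCA lerDl addr_ge0 ?sumr_ge0.
apply: Pmono (PM0 n n0n); apply: le_trans (ler_norm _) _.
by rewrite lerDl sumr_ge0.
Qed.

Lemma periodic_modn (X : Type) (Y : nat -> X) N : (forall n, Y (n + N)%N = Y n) ->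
  forall k i, Y (k * N + i)%N = Y i.
Proof.
move=> YN; elim=> [|k IHk] i; first by rewrite add0n.
by rewrite mulSn -addnA addnC YN.
Qed.

Variables (H : hilbertType R) (N : nat).
Hypothesis N0 : (0 < N)%N.

Lemma opnorm_periodic_bounded (Y : nat -> H -> H) :
  (forall n, bounded_operator (Y n)) -> (forall n, Y (n + N)%N = Y n) ->
  exists2 M, 0 <= M & forall n, opnorm (Y n) <= M.
Proof.
move=> bY YN; have Y0 n := opnorm_ge0 (bY n).
exists (\sum_(i < N) opnorm (Y i)); first by rewrite sumr_ge0.
move=> n; rewrite (divn_eq n N) (periodic_modn YN).
have nN : (n %% N < N)%N by rewrite ltn_mod.
by rewrite (bigD1 (Ordinal nN)) //= lerDl sumr_ge0.
Qed.

Lemma asymptotically_periodic_bounded (X Y : nat -> H -> H) :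
  (forall n, bounded_operator (X n)) -> (forall n, bounded_operator (Y n)) ->
  (forall n, Y (n + N)%N = Y n) ->
  opnorm (X n - Y n) @[n --> \oo] --> (0 : R) ->
  exists2 M, 0 <= M & forall n, opnorm (X n) <= M.
Proof.
move=> bX bY YN XY; have [MY MY0 YM] := opnorm_periodic_bounded bY YN.
apply: uniform_of_eventual.
- by move=> n M M' MM' XM; apply: le_trans MM'.
- by move=> n; exists (opnorm (X n)).
exists (1 + MY).
have := @cvgr0Pnorm_le R _ _ _ eventually_filter (fun n => opnorm (X n - Y n)).
move=> [/(_ XY _ ltr01) + _]; apply: filterS => n XYn.
have D0 := opnorm_ge0 (bounded_operatorB (bX n) (bY n)).
apply: opnorm_le; first by rewrite addr_ge0.
move=> x; have -> : X n x = (X n - Y n) x + Y n x.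
  by rewrite -[(X n - Y n) x]/(X n x - Y n x) subrK.
apply: le_trans (ler_hnormD _ _) _; rewrite mulrDl lerD //.
  apply: le_trans (le_opnorm _ (bounded_operatorB (bX n) (bY n))) _.
  by rewrite ler_wpM2r ?hnorm_ge0 // (le_trans (ler_norm _)).
apply: le_trans (le_opnorm _ (bY n)) _.
by rewrite ler_wpM2r ?hnorm_ge0.
Qed.

(** [a_n / ||a_n||] is eventually bounded below, being close to a periodic
    sequence of invertible operators; a lower bound for [a_n / ||a_n||] is an
    upper bound for [||a_n|| a_n^-1]. *)
Lemma opinv_le_of_normalised_limit (a C : nat -> H -> H) :
  (forall n, bounded_operator (a n)) -> (forall n, boundedly_invertible (a n)) ->
  (forall n, bounded_operator (C n)) -> (forall n, boundedly_invertible (C n)) ->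
  (forall n, C (n + N)%N = C n) ->
  opnorm ((opnorm (a n))^-1%:C *: a n - C n) @[n --> \oo] --> (0 : R) ->
  exists2 M, 0 <= M & forall n, opnorm (a n) * opnorm (opinv (a n)) <= M.
Proof.
move=> ba ia bC iC CN aC.
have bP n : bounded_operator (opinv (a n)) by case: (opinv_spec (ia n)).
have bD n := bounded_operatorB (bounded_operatorZ (opnorm (a n))^-1 (ba n)) (bC n).
have bCi n : bounded_operator (opinv (C n)) by case: (opinv_spec (iC n)).
have [|M M0 CM] := @opnorm_periodic_bounded (fun n => opinv (C n)) bCi.
  by move=> n; rewrite CN.
apply: uniform_of_eventual.
- by move=> n K K' KK' XK; apply: le_trans KK'.
- by move=> n; exists (opnorm (a n) * opnorm (opinv (a n))).
exists (2 * M).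
(* a perturbation of this size costs at most half of the lower bound of C n *)
have e0 : 0 < (2 * (M + 1))^-1 by rewrite invr_gt0 mulr_gt0 // ltr_wpDl.
have := @cvgr0Pnorm_le R _ _ _ eventually_filter
  (fun n => opnorm ((opnorm (a n))^-1%:C *: a n - C n)).
move=> [/(_ aC _ e0) + _]; apply: filterS => n aCn.
set al := opnorm (a n) in aCn *.
have al0 : 0 <= al by apply: opnorm_ge0.
have [_ _ aK'] := opinv_spec (ia n).
have [_ CK _] := opinv_spec (iC n).
have key y : al * hnorm (opinv (a n) y) <= 2 * M * hnorm y.
  set x := opinv (a n) y.
  have ax : a n x = y by rewrite /x aK'.
  have [al00|aln] := eqVneq al 0.
    by rewrite al00 mul0r !mulr_ge0 ?hnorm_ge0.
  have alp : 0 < al by rewrite lt_neqAle eq_sym aln.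
  have h1 : hnorm x <= M * hnorm (C n x).
    rewrite -{1}(CK x); apply: le_trans (le_opnorm _ (bCi n)) _.
    by rewrite ler_wpM2r ?hnorm_ge0.
  have h2 : hnorm (C n x) <= al^-1 * hnorm y + (2 * (M + 1))^-1 * hnorm x.
    have -> : C n x = al^-1%:C *: y - (al^-1%:C *: a n - C n) x.
      by rewrite -[(_ - C n) x]/(al^-1%:C *: a n x - C n x) ax opprB addrC subrK.
    apply: le_trans (ler_hnormB _ _) _.
    rewrite hnorm_scale ger0_norm ?invr_ge0 // lerD2l.
    apply: le_trans (le_opnorm _ (bD n)) _.
    by rewrite ler_wpM2r ?hnorm_ge0 // (le_trans (ler_norm _)).
  have x0 := hnorm_ge0 x.
  have h3 : M * ((2 * (M + 1))^-1 * hnorm x) <= 2^-1 * hnorm x.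
    rewrite mulrA ler_wpM2r // ler_pdivrMr ?mulr_gt0 ?ltr_wpDl //.
    lra.
  have h4 : hnorm x <= 2 * (M * (al^-1 * hnorm y)).
    have := ler_wpM2l M0 h2; rewrite mulrDr; lra.
  apply: le_trans (ler_wpM2l al0 h4) _.
  by rewrite le_eqVlt; apply/orP; left; apply/eqP; field.
have [al00|aln] := eqVneq al 0; first by rewrite al00 mul0r mulr_ge0.
have alp : 0 < al by rewrite lt_neqAle eq_sym aln.
rewrite mulrC -ler_pdivlMr //; apply: opnorm_le; first by rewrite divr_ge0 ?mulr_ge0.
by move=> y; rewrite mulrAC ler_pdivlMr // mulrC.
Qed.

End uniformity.

(** * Coercivity near the limit *)

Section coercivity.
Variables (R : realType) (H : hilbertType R) (a b : nat -> H -> H) (N : nat).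
Variables (T Q S C : nat -> H -> H).
Hypotheses (ba : forall n, bounded_operator (a n))
  (bb : forall n, bounded_operator (b n))
  (ia : forall n, boundedly_invertible (a n)) (N0 : (0 < N)%N)
  (bT : forall n, bounded_operator (T n)) (bQ : forall n, bounded_operator (Q n))
  (bS : forall n, bounded_operator (S n)) (bC : forall n, bounded_operator (C n))
  (TN : forall n, T (n + N)%N = T n) (QN : forall n, Q (n + N)%N = Q n)
  (SN : forall n, S (n + N)%N = S n) (CN : forall n, C (n + N)%N = C n)
  (Tlim : opnorm (recT a n - T n) @[n --> \oo] --> (0 : R))
  (Qlim : opnorm (recQ a b n - Q n) @[n --> \oo] --> (0 : R))
  (Slim : opnorm (recS a n - S n) @[n --> \oo] --> (0 : R))
  (Clim : opnorm ((opnorm (a n))^-1%:C *: a n - C n) @[n --> \oo] --> (0 : R)).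

Definition monodromy lam n := ordered_prod N (fun i => transfer a b lam (n + i)%N).

(** The index is a multiple of [N], so that the product starts at phase 0, the
    phase at which [calF] is formed. *)
Definition coercive_at (c lam : R) k := forall v : dsum H,
  c * opnorm (a (k * N + N).-1) * hnorm v ^+ 2
  <= `|turan_form (a (k * N + N).-1) (monodromy lam (k * N) v) v|.

(** The form at index [k N], divided by [||a_(kN+N-1)||], differs from the
    limiting form at [lam0] by the change of the outer operator and the change
    of the product, both as small as desired for [k] large and lam close to
    [lam0]. *)
Lemma coercive_near lam0 : Lambda N T Q S C lam0 ->
  exists c d k0, [/\ 0 < c, 0 < d & forall lam k, `|lam - lam0| < d ->
    (k0 <= k)%N -> coercive_at c lam k].
Proof.
move=> /(Lambda_coercive bT bQ bS bC) [c0 c00 coer].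
have bP := bounded_recT ia. have bq := bounded_recQ bb ia.
have bs := bounded_recS ba ia.
have [MT MT0 TM] := opnorm_periodic_bounded N0 bT TN.
have [MQ MQ0 QM] := opnorm_periodic_bounded N0 bQ QN.
have [MS MS0 SM] := opnorm_periodic_bounded N0 bS SN.
have [MC MC0 CM] := opnorm_periodic_bounded N0 bC CN.
have [MP MP0 PM] := asymptotically_periodic_bounded N0 bP bT TN Tlim.
pose M := 1 + MS + `|lam0| * MT + MQ.
have M0 : 0 <= M by rewrite !addr_ge0 ?mulr_ge0.
pose G := (M + 1) ^+ N.
have G0 : 0 < G by rewrite exprn_gt0 // ltr_wpDl.
(* eta is the allowed perturbation of a single factor and of the normalised
   a_(kN+N-1); with it the form changes by at most half of its lower bound.
   Adding c0 to B is what makes eta at most 1. *)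
pose B := 1 + 2 * G + 2 * MC * (N%:R * G) + c0.
have N0' : 0 <= N%:R :> R by [].
have B0 : 0 < B.
  have : 0 <= MC * (N%:R * G) by rewrite !mulr_ge0 ?(ltW G0).
  rewrite /B; lra.
pose eta := c0 / (2 * B).
have eta0 : 0 < eta by rewrite divr_gt0 ?mulr_gt0.
have etaB : eta * B = c0 / 2 by rewrite /eta; field; rewrite gt_eqF.
have eta1 : eta <= 1.
  rewrite /eta ler_pdivrMr ?mulr_gt0 // mul1r /B.
  have : 0 <= MC * (N%:R * G) by rewrite !mulr_ge0 ?(ltW G0).
  lra.
have lim_small (u : nat -> R) e : 0 < e -> u n @[n --> \oo] --> 0 ->
    exists n0, forall n, (n0 <= n)%N -> u n <= e.
  move=> e0 /cvgr0Pnorm_le /(_ e e0) [n0 _ un0]; exists n0 => n /un0.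
  exact: le_trans (ler_norm _).
have l1 : 0 < `|lam0| + 1 by rewrite ltr_wpDl.
have e4 : 0 < eta / 4 by rewrite divr_gt0.
have [nT hT] := lim_small _ _ (divr_gt0 e4 l1) Tlim.
have [nQ hQ] := lim_small _ _ e4 Qlim.
have [nS hS] := lim_small _ _ e4 Slim.
have [nC hC] := lim_small _ _ eta0 Clim.
have P1 : 0 < MP + 1 by rewrite ltr_wpDl.
pose n0 := maxn (maxn nT nQ) (maxn nS nC).
exists (c0 / 2), (eta / 4 / (MP + 1)), n0.
split; [by rewrite divr_gt0 | by rewrite divr_gt0 |].
move=> lam k lamd kk v.
have kN : (k <= k * N)%N by rewrite leq_pmulr.
have big n1 i : (n1 <= n0)%N -> (n1 <= k * N + i)%N.
  by move=> h; rewrite (leq_trans h) // (leq_trans kk) // (leq_trans kN) // leq_addr.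
have [[bT1 bT2] [bT3 bT4]] : ((nT <= n0 /\ nQ <= n0) /\ (nS <= n0 /\ nC <= n0))%N.
  by rewrite /n0 !leq_max !leqnn !orbT.
set X := ordered_prod N (limit_transfer T Q S lam0).
have bX i : bounded_operator (limit_transfer T Q S lam0 i).
  exact: bounded_limit_transfer.
have XM i x : (i < N)%N -> hnorm (limit_transfer T Q S lam0 i x) <= M * hnorm x.
  move=> _; apply: le_trans (limit_transfer_le bT bQ bS _ _ _) _.
  by rewrite ler_wpM2r ?hnorm_ge0 // !lerD // ler_wpM2l.
have YX i x : (i < N)%N -> hnorm (transfer a b lam (k * N + i) x
    - limit_transfer T Q S lam0 i x) <= eta * hnorm x.
  move=> _; apply: le_trans (limit_transfer_diff bP bq bs bT bQ bS _ _ _ _ _) _.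
  rewrite ler_wpM2r ?hnorm_ge0 //.
  rewrite -(periodic_modn TN k) -(periodic_modn QN k) -(periodic_modn SN k).
  have t1 : `|lam - lam0| * opnorm (recT a (k * N + i)) <= eta / 4.
    have -> : eta / 4 = eta / 4 / (MP + 1) * (MP + 1) by field; rewrite gt_eqF.
    rewrite ler_pM ?opnorm_ge0 // ?ltW //.
    by apply: le_lt_trans (PM _) _; rewrite ltrDl.
  have t2 : `|lam0| * opnorm (recT a (k * N + i) - T (k * N + i)) <= eta / 4.
    have -> : eta / 4 = (`|lam0| + 1) * (eta / 4 / (`|lam0| + 1)).
      by field; rewrite gt_eqF.
    rewrite ler_pM ?opnorm_ge0 ?lerDl ?hT ?big //.
    exact: bounded_operatorB.
  have := hQ _ (big _ i bT2); have := hS _ (big _ i bT3); lra.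
have w_diff := ordered_prod_perturb M0 _ (fun i => (bX i).1) XM YX v.
have {}w_diff : hnorm (monodromy lam (k * N) v - X v) <= eta * (N%:R * G) * hnorm v.
  by rewrite mulrA; apply: w_diff; rewrite (ltW eta0).
have wG : hnorm (monodromy lam (k * N) v) <= G * hnorm v.
  apply: ordered_prod_le => [|i x iN]; first by rewrite addr_ge0.
  rewrite -[transfer _ _ _ _ x](subrK (limit_transfer T Q S lam0 i x)).
  apply: le_trans (ler_hnormD _ _) _; rewrite mulrDl mul1r addrC lerD ?XM //.
  apply: le_trans (YX _ _ iN) _; by rewrite ler_piMl ?hnorm_ge0.
set w := monodromy lam (k * N) v in w_diff wG *.
pose m := (k * N + N.-1)%N.
have mE : (k * N + N).-1 = m by rewrite /m -subn1 -addnBA // subn1.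
rewrite mE; set al := opnorm (a m).
have [al0|aln] := eqVneq al 0; first by rewrite al0 mulr0 mul0r.
have alp : 0 < al by rewrite lt_neqAle eq_sym aln opnorm_ge0.
have bA := bounded_operatorZ al^-1 (ba m).
have CE : C m = C N.-1 by rewrite /m periodic_modn.
have bD : bounded_operator (al^-1%:C *: a m - C m) by exact: bounded_operatorB.
have f1 : `|turan_form (al^-1%:C *: a m - C m) w v| <= 2 * eta * (G * hnorm v) * hnorm v.
  apply: le_trans (turan_form_le _ _ bD) _; rewrite ler_wpM2r ?hnorm_ge0 //.
  rewrite ler_pM ?mulr_ge0 ?opnorm_ge0 ?hnorm_ge0 // ler_wpM2l //.
  exact: hC (big _ N.-1 bT4).
have f2 : `|turan_form (C m) (w - X v) v| <= 2 * MC * (eta * (N%:R * G) * hnorm v) * hnorm v.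
  apply: le_trans (turan_form_le _ _ (bC _)) _; rewrite ler_wpM2r ?hnorm_ge0 //.
  by rewrite ler_pM ?mulr_ge0 ?opnorm_ge0 ?hnorm_ge0 // ler_wpM2l.
have f3 := coer v; rewrite -CE -/X in f3.
have fE : turan_form (C m) (X v) v = al^-1 * turan_form (a m) w v
    - turan_form (al^-1%:C *: a m - C m) w v - turan_form (C m) (w - X v) v.
  rewrite turan_formB turan_formBl // turan_formZ; ring.
have f4 : c0 / 2 * hnorm v ^+ 2 <= al^-1 * `|turan_form (a m) w v|.
  have h0 : 2 * eta * (G * hnorm v) * hnorm v + 2 * MC * (eta * (N%:R * G) * hnorm v) * hnorm v
     <= c0 / 2 * hnorm v ^+ 2.
    rewrite -etaB.
    have -> : 2 * eta * (G * hnorm v) * hnorm v + 2 * MC * (eta * (N%:R * G) * hnorm v) * hnorm v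
      = eta * (2 * G + 2 * MC * (N%:R * G)) * hnorm v ^+ 2 by ring.
    rewrite ler_wpM2r ?exprn_ge0 ?hnorm_ge0 // ler_wpM2l ?(ltW eta0) // /B; lra.
  have h1 : `|turan_form (C m) (X v) v| <= al^-1 * `|turan_form (a m) w v|
      + `|turan_form (al^-1%:C *: a m - C m) w v| + `|turan_form (C m) (w - X v) v|.
    have -> : al^-1 * `|turan_form (a m) w v| = `|al^-1 * turan_form (a m) w v|.
      by rewrite normrM ger0_norm // invr_ge0 ltW.
    rewrite fE; apply: (le_trans (ler_normB _ _)); rewrite lerD2r.
    exact: ler_normB.
  lra.
move: f4; rewrite mulrC ler_pdivlMl // mulrA => h.
by apply: le_trans h; rewrite le_eqVlt; apply/orP; left; apply/eqP; ring.
Qed.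

Lemma coercive_on_compact (K : set R) : compact K -> K `<=` Lambda N T Q S C ->
  exists c k0, 0 < c /\ forall lam k, K lam -> (k0 <= k)%N -> coercive_at c lam k.
Proof.
move=> /compact_near_coveringP Kcov KL.
(* i serves both as the threshold for k and, inverted, as the constant *)
pose P i lam := forall k, (i <= k)%N -> coercive_at i.+1%:R^-1 lam k.
have [|k0 _ h] := Kcov nat \oo P eventually_filter.
  move=> lam0 /KL /coercive_near [c [d [k0 [c0 d0 near_lam0]]]].
  have [i ic] : exists i : nat, i.+1%:R^-1 <= c.
    exists (Num.bound c^-1); rewrite -[leRHS]invrK lef_pV2 ?posrE ?invr_gt0 //.
    have h : c^-1 < (Num.bound c^-1)%:R by apply: archi_boundP; rewrite invr_ge0 ltW.
    by apply: le_trans (ltW h) _; rewrite ler_nat.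
  exists (ball lam0 d, [set n | (maxn i k0 <= n)%N]) => /=.
    split; first exact: nbhsx_ballx.
    by exists (maxn i k0).
  move=> [lam n] /= [lamd]; rewrite geq_max => /andP[i_n k0n] k nk v.
  have {}lamd : `|lam - lam0| < d by rewrite distrC.
  apply: le_trans (near_lam0 _ _ lamd (leq_trans k0n nk) v).
  rewrite -!mulrA ler_wpM2r ?mulr_ge0 ?opnorm_ge0 ?exprn_ge0 ?hnorm_ge0 //.
  by apply: le_trans ic; rewrite lef_pV2 ?posrE // ler_nat.
exists k0.+1%:R^-1, k0; split; first by rewrite invr_gt0.
by move=> lam k Klam k0k; apply: (h k0 (leqnn _) lam Klam).
Qed.

End coercivity.

(** * Ratios of consecutive coefficients *)

Section ratios.
Variables (R : realType) (H : hilbertType R) (a b : nat -> H -> H) (N : nat).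
Hypotheses (ba : forall n, bounded_operator (a n))
  (bb : forall n, bounded_operator (b n))
  (ia : forall n, boundedly_invertible (a n)) (N0 : (0 < N)%N).

Lemma opnorm_gt0 n (x : H) : x != 0 -> 0 < opnorm (a n).
Proof.
move=> x0; rewrite lt_neqAle opnorm_ge0 // andbT eq_sym; apply/eqP => a0.
have := le_opnorm x (ba n); rewrite a0 mul0r leNgt hnorm_gt0 => /negP; apply.
apply: contraNN x0 => /eqP ax.
by rewrite -(recT_aK ia n x) ax (op_zero (bounded_recT ia n).1).
Qed.

(** A single coercive lam suffices: coercivity bounds the product over a period
    below, hence each of its factors; on vectors [(x, 0)] a factor is
    [- recS n x].  In particular the limits of [recS] cannot vanish. *)
Lemma recS_lower_of_coercive (c lam M : R) (k0 : nat) :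
  (forall n, 0 < opnorm (a n)) -> 0 < c -> 1 <= M ->
  (forall n x, hnorm (transfer a b lam n x) <= M * hnorm x) ->
  (forall k, (k0 <= k)%N -> coercive_at a b N c lam k) ->
  exists2 K, 0 <= K & forall n x, hnorm x <= K * hnorm (recS a n x).
Proof.
move=> a0 c0 M1 tM coer.
apply: uniform_of_eventual.
- move=> n K K' KK' XK x; apply: le_trans (XK x) _.
  by rewrite ler_wpM2r ?hnorm_ge0.
- move=> n; have [X [bX XK _]] := recS_inj ba ia n.
  by exists (opnorm X) => x; rewrite -{1}(XK x) le_opnorm.
exists (2 / c * M ^+ N); exists (k0 * N)%N => // n /= kn x.
have kk : (k0 <= n %/ N)%N by rewrite leq_divRL.
set k := (n %/ N)%N in kk.
have mono_low w : c / 2 * hnorm w <= hnorm (monodromy a b N lam (k * N) w).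
  have [->|w0] := eqVneq w 0; first by rewrite hnorm0 mulr0 hnorm_ge0.
  have hw : 0 < hnorm w by rewrite hnorm_gt0.
  have := le_trans (coer _ kk w) (turan_form_le _ _ (ba _)).
  set al := opnorm _; have al0 : 0 < al := a0 _.
  set y := hnorm (monodromy _ _ _ _ _ _) => h.
  rewrite -(ler_pM2r (mulr_gt0 al0 hw)).
  have -> : c / 2 * hnorm w * (al * hnorm w) = c * al * hnorm w ^+ 2 / 2 by field.
  rewrite ler_pdivrMr //; apply: le_trans h _.
  by rewrite le_eqVlt; apply/orP; left; apply/eqP; ring.
have jN : (n %% N < N)%N by rewrite ltn_mod.
have c2 : 0 <= c / 2 by rewrite divr_ge0 ?ltW.
have := ordered_prod_lower M1 (fun i y _ => tM (k * N + i)%N y)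
  (fun i y _ => transfer_surj b ba ia lam (k * N + i)%N y) mono_low c2 ((x, 0) : dsum H) jN.
rewrite -divn_eq /transfer limit_transferE /= => h.
have h1 : hnorm x <= hnorm ((x, 0) : dsum H) by apply: (hnorm_fst ((x, 0) : dsum H)).
have h2 : hnorm ((0, - recS a n x + (lam%:C *: recT a n 0 - recQ a b n 0)) : dsum H)
    <= hnorm (recS a n x).
  apply: le_trans (hnorm_dsum_le _) _ => /=.
  rewrite (op_zero (bounded_recT ia n).1) (op_zero (bounded_recQ bb ia n).1).
  by rewrite scaler0 subrr addr0 hnorm0 add0r hnorm_opp.
have MN : 0 <= M ^+ N by rewrite exprn_ge0 // (le_trans _ M1).
have h3 : c / 2 * hnorm x <= M ^+ N * hnorm (recS a n x).
  apply: le_trans (ler_wpM2l c2 h1) _; apply: le_trans h _.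
  exact: ler_wpM2l.
have -> : hnorm x = 2 / c * (c / 2 * hnorm x) by field; rewrite gt_eqF.
by rewrite -[leRHS]mulrA ler_wpM2l // divr_ge0 // ltW.
Qed.

(** From [|x| <= K |a_n^-1 a_(n-1)^* x|] and [||a_n^-1|| <= M / ||a_n||]. *)
Lemma opnorm_ratio_up (K M : R) n (x : H) : x != 0 -> 0 <= K ->
  (forall x, hnorm x <= K * hnorm (recS a n x)) ->
  opnorm (a n) * opnorm (recT a n) <= M ->
  opnorm (a n) <= K * M * opnorm (a n.-1).
Proof.
move=> x0 K0 SK aT.
have hx : 0 < hnorm x by rewrite hnorm_gt0.
have al0 := opnorm_ge0 (ba n).
rewrite -(ler_pM2r hx); apply: le_trans (ler_wpM2l al0 (SK x)) _.
rewrite mulrCA -!mulrA ler_wpM2l //.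
have h := le_opnorm (adjoint (a n.-1) x) (bounded_recT ia n).
have h' := hnorm_adjoint_le x (ba n.-1).
apply: le_trans (ler_wpM2l al0 h) _; rewrite [leLHS]mulrA.
have tP := opnorm_ge0 (bounded_recT ia n).
apply: ler_pM; [exact: mulr_ge0 | exact: hnorm_ge0 | exact: aT | exact: h'].
Qed.

(** From the factorisation [a_(n-1)^* = a_n (a_n^-1 a_(n-1)^* )]. *)
Lemma opnorm_ratio_down (M : R) n : opnorm (recS a n) <= M ->
  opnorm (a n.-1) <= M * opnorm (a n).
Proof.
move=> SM.
have bs := bounded_recS ba ia n.
have M0 : 0 <= M by apply: le_trans SM; apply: opnorm_ge0.
rewrite -{1}(adjointK (ba n.-1)); apply: opnorm_le.
  by rewrite mulr_ge0 ?opnorm_ge0.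
move=> x; apply: le_trans (hnorm_adjoint_le _ (bounded_adjoint (ba _))) _.
rewrite ler_wpM2r ?hnorm_ge0 //; apply: opnorm_le.
  by rewrite mulr_ge0 ?opnorm_ge0.
move=> y; rewrite -(recTK ia n (adjoint _ y)).
apply: le_trans (le_opnorm _ (ba n)) _; rewrite mulrC mulrAC ler_wpM2r ?opnorm_ge0 //.
apply: le_trans (le_opnorm y bs) _.
by rewrite ler_wpM2r ?hnorm_ge0.
Qed.

Lemma variation_sums (x : nat -> H -> H) n0 :
  (forall n, bounded_operator (x n)) -> (operator_variation N n0 x < +oo)%E ->
  exists D, forall n, \sum_(n0 <= i < n) opnorm (x (i + N)%N - x i) <= D.
Proof.
move=> bx fin.
have d0 n : 0 <= opnorm (x (n + N)%N - x n) by apply/opnorm_ge0/bounded_operatorB.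
exists (fine (operator_variation N n0 x)) => n.
rewrite -lee_fin fineK.
  rewrite -sumEFin; apply: (@nneseries_lim_ge R (fun i => (opnorm (x (i + N)%N - x i))%:E) xpredT).
  by move=> i _ _; rewrite lee_fin.
rewrite ge0_fin_numE //; apply: nneseries_ge0 => i _ _.
by rewrite lee_fin.
Qed.

Lemma operator_variation_ge0 (x : nat -> H -> H) n0 :
  (forall n, bounded_operator (x n)) -> (0 <= operator_variation N n0 x)%E.
Proof.
move=> bx; apply: nneseries_ge0 => i _ _.
by rewrite lee_fin; apply/opnorm_ge0/bounded_operatorB.
Qed.

End ratios.

(** * The Turan determinant against the energy *)

Section growth.
Variables (R : realType) (H : hilbertType R) (a b : nat -> H -> H) (N : nat).
Hypotheses (ba : forall n, bounded_operator (a n))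
  (bb : forall n, bounded_operator (b n))
  (ia : forall n, boundedly_invertible (a n)) (N0 : (0 < N)%N)
  (sb : forall n, self_adjoint (b n)).

Definition period_defect n :=
  opnorm (recT a (n + N) - recT a n) + opnorm (recQ a b (n + N) - recQ a b n)
  + opnorm (recS a (n + N) - recS a n).

Lemma period_defect_ge0 n : 0 <= period_defect n.
Proof.
have bP := bounded_recT ia; have bq := bounded_recQ bb ia.
have bs := bounded_recS ba ia.
by rewrite /period_defect !addr_ge0 //; apply/opnorm_ge0/bounded_operatorB.
Qed.

Variables (La Lw kap lam : R) (u : nat -> H).
Hypotheses (La1 : 1 <= La) (Lw1 : 1 <= Lw) (lamk : `|lam| <= kap)
  (ev : generalised_eigenvector a b lam%:C u)
  (a_up : forall n, opnorm (a n.+1) <= La * opnorm (a n))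
  (a_down : forall n, opnorm (a n) <= La * opnorm (a n.+1))
  (w_up : forall n, (1 <= n)%N ->
     hnorm (state u n.+1) <= Lw * hnorm (state u n)).

Definition energy n := opnorm (a n) * hnorm (state u n) ^+ 2.

Lemma energy_ge0 n : 0 <= energy n.
Proof. by rewrite mulr_ge0 ?opnorm_ge0 ?exprn_ge0 ?hnorm_ge0. Qed.

Let a_ge0 n : 0 <= opnorm (a n) := opnorm_ge0 (ba n).
Let La0 : 0 <= La := le_trans ler01 La1.
Let Lw0 : 0 <= Lw := le_trans ler01 Lw1.

Lemma opnorm_iter m j : opnorm (a (m + j)%N) <= La ^+ j * opnorm (a m).
Proof. by apply: (@ratio_iter _ (fun i => opnorm (a i))). Qed.

Lemma opnorm_iter_rev m j : opnorm (a m) <= La ^+ j * opnorm (a (m + j)%N).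
Proof. by apply: (@ratio_iter_rev _ (fun i => opnorm (a i))). Qed.

Lemma state_norm_iter m j : (1 <= m)%N ->
  hnorm (state u (m + j)) <= Lw ^+ j * hnorm (state u m).
Proof.
move=> m1; apply: (@ratio_iter _ (fun i => hnorm (state u i))) => // i mi.
by rewrite w_up // (leq_trans m1).
Qed.

Lemma turan_variation m : (1 <= m)%N ->
  `|turan a u N m.+1 - turan a u N m|
  <= Lw ^+ N * La ^+ N * (kap + 1) * period_defect m * energy m.
Proof.
move=> m1.
have bP := bounded_recT ia; have bq := bounded_recQ bb ia.
have bs := bounded_recS ba ia.
rewrite distrC (turan_step ba bb ia sb ev) //.
apply: le_trans (rdot_le_norm _ _) _.
have e1 : hnorm (u (m + N)%N) <= Lw ^+ N * hnorm (state u m).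
  exact: le_trans (hnorm_snd (state u (m + N))) (state_norm_iter _ m1).
set D := transfer a b lam (m + N) _ - _.
have e2 : hnorm D <= (kap + 1) * period_defect m * hnorm (state u m).
  apply: le_trans (limit_transfer_diff bP bq bs bP bq bs _ _ _ _ _) _.
  rewrite ler_wpM2r ?hnorm_ge0 // subrr normr0 mul0r add0r /period_defect.
  have p0 := opnorm_ge0 (bounded_operatorB (bP (m + N)%N) (bP m)).
  have q0 := opnorm_ge0 (bounded_operatorB (bq (m + N)%N) (bq m)).
  have s0 := opnorm_ge0 (bounded_operatorB (bs (m + N)%N) (bs m)).
  have kap0 : 0 <= kap by apply: le_trans lamk.
  have := ler_wpM2r p0 lamk; have := mulr_ge0 kap0 q0; have := mulr_ge0 kap0 s0.
  lra.
have e3 : hnorm (a (m + N)%N D.2)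
    <= La ^+ N * opnorm (a m) * ((kap + 1) * period_defect m * hnorm (state u m)).
  apply: le_trans (le_opnorm _ (ba _)) _.
  rewrite ler_pM ?hnorm_ge0 //; first exact: opnorm_iter.
  exact: le_trans (hnorm_snd D) e2.
apply: le_trans (ler_pM (hnorm_ge0 _) (hnorm_ge0 _) e1 e3) _.
by rewrite le_eqVlt; apply/orP; left; apply/eqP; rewrite /energy; ring.
Qed.

Lemma turan_le_energy m : (1 <= m)%N ->
  `|turan a u N m| <= 2 * La ^+ N * Lw ^+ N * energy m.
Proof.
move=> m1; apply: le_trans (turan_form_le _ _ (ba _)) _.
have -> : (m + N).-1 = (m + N.-1)%N by rewrite -subn1 -addnBA // subn1.
have e2 : opnorm (a (m + N.-1)%N) <= La ^+ N * opnorm (a m).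
  apply: le_trans (opnorm_iter _ _) _; rewrite ler_wpM2r //.
  by rewrite ler_weXn2l // leq_pred.
have e3 : 2 * opnorm (a (m + N.-1)%N) * hnorm (state u (m + N))
    <= 2 * (La ^+ N * opnorm (a m)) * (Lw ^+ N * hnorm (state u m)).
  by rewrite ler_pM ?mulr_ge0 ?hnorm_ge0 ?state_norm_iter // ler_wpM2l.
apply: le_trans (ler_wpM2r (hnorm_ge0 _) e3) _.
by rewrite le_eqVlt; apply/orP; left; apply/eqP; rewrite /energy; ring.
Qed.

(** Coercivity bounds the form below by [||a_(m+N-1)||], while the energy
    carries [||a_m||]: the two differ by at most [N - 1] ratios. *)
Lemma energy_le_turan c k : 0 <= c -> (1 <= k)%N -> coercive_at a b N c lam k ->
  c / La ^+ N * energy (k * N) <= `|turan a u N (k * N)|.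
Proof.
move=> c0 k1 coer; set m := (k * N)%N.
have m1 : (1 <= m)%N by rewrite muln_gt0 k1.
have LaN : 0 < La ^+ N by rewrite exprn_gt0 // (lt_le_trans _ La1).
have := coer (state u m).
rewrite /monodromy -(state_iter ia ev) // -/(turan a u N m) => h.
apply: le_trans h.
have -> : (m + N).-1 = (m + N.-1)%N by rewrite -subn1 -addnBA // subn1.
rewrite /energy mulrA ler_wpM2r ?exprn_ge0 ?hnorm_ge0 //.
rewrite mulrAC ler_pdivrMr // -mulrA ler_wpM2l //.
apply: le_trans (opnorm_iter_rev m N.-1) _.
by rewrite mulrC ler_wpM2l // ler_weXn2l // leq_pred.
Qed.

End growth.

(** * Two-sided bounds for generalised eigenvectors *)

Theorem theorem2 (R : realType) (H : hilbertType R)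
  (a b : nat -> H -> H)
  (a_bounded : forall n, bounded_operator (a n))
  (b_bounded : forall n, bounded_operator (b n))
  (a_invertible : forall n, boundedly_invertible (a n))
  (b_self_adjoint : forall n, self_adjoint (b n))
  (N : nat) (N_ge1 : (1 <= N)%N)
  (variation_finite :
    (operator_variation N 0 (fun n => opinv (a n))
     + operator_variation N 0 (fun n => opinv (a n) \o b n)
     + operator_variation N 1 (fun n => opinv (a n) \o adjoint (a n.-1))
     < +oo)%E)
  (T Q S C : nat -> H -> H)
  (T_bounded : forall n, bounded_operator (T n))
  (Q_bounded : forall n, bounded_operator (Q n))
  (S_bounded : forall n, bounded_operator (S n))
  (C_bounded : forall n, bounded_operator (C n))
  (T_periodic : forall n, T (n + N)%N = T n)
  (Q_periodic : forall n, Q (n + N)%N = Q n)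
  (S_periodic : forall n, S (n + N)%N = S n)
  (C_periodic : forall n, C (n + N)%N = C n)
  (T_limit : opnorm (opinv (a n) - T n) @[n --> \oo] --> (0 : R))
  (Q_limit : opnorm (opinv (a n) \o b n - Q n) @[n --> \oo] --> (0 : R))
  (S_limit :
    opnorm (opinv (a n) \o adjoint (a n.-1) - S n) @[n --> \oo] --> (0 : R))
  (C_limit :
    opnorm ((opnorm (a n))^-1%:C *: a n - C n) @[n --> \oo] --> (0 : R))
  (C_invertible : forall n, boundedly_invertible (C n))
  (K : set R) (K_compact : compact K) (K_sub : K `<=` Lambda N T Q S C) :
  exists c1 c2 : R, [/\ 0 < c1, 0 < c2 &
    forall (lam : R) (u : nat -> H), K lam ->
      generalised_eigenvector a b lam%:C u ->
      forall n : nat, (1 <= n)%N ->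
        c1 * (hnorm (u 0%N) ^+ 2 + hnorm (u 1%N) ^+ 2)
          <= opnorm (a n) * (hnorm (u n.-1) ^+ 2 + hnorm (u n) ^+ 2)
          <= c2 * (hnorm (u 0%N) ^+ 2 + hnorm (u 1%N) ^+ 2)].
Proof.
(* Without a nonzero vector there is no eigenvector, and all the norms
   opnorm (a n) vanish. *)
have [[x0 x0n]|Htriv] := pselect (exists x : H, x != 0); last first.
  exists 1, 1; split => // lam u _ [[n un] _].
  by case: Htriv; exists (u n).
(* A point of K is needed: the ratio bounds come from coercivity. *)
have [[lam0 Klam0]|K0] := pselect (exists lam, K lam); last first.
  by exists 1, 1; split => // lam u Klam; case: K0; exists lam.
have [ba bb ia] : [/\ forall n, bounded_operator (a n),
  forall n, bounded_operator (b n) & forall n, boundedly_invertible (a n)] by [].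
have sb : forall n, self_adjoint (b n) by [].
have a_gt0 n := opnorm_gt0 ba ia n x0n.
have bP := bounded_recT ia. have bq := bounded_recQ bb ia.
have bs := bounded_recS ba ia.
have [c [k0 [c0 coer]]] := coercive_on_compact ba bb ia N_ge1 T_bounded Q_bounded
  S_bounded C_bounded T_periodic Q_periodic S_periodic C_periodic T_limit Q_limit
  S_limit C_limit K_compact K_sub.
have [MP MP0 PM] := asymptotically_periodic_bounded N_ge1 bP T_bounded T_periodic T_limit.
have [MQ MQ0 QM] := asymptotically_periodic_bounded N_ge1 bq Q_bounded Q_periodic Q_limit.
have [MS MS0 SM] := asymptotically_periodic_bounded N_ge1 bs S_bounded S_periodic S_limit.
have [MI MI0 IM] := opinv_le_of_normalised_limit N_ge1 ba ia C_bounded C_invertible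
  C_periodic C_limit.
have [kap kap0 Kkap] : exists2 kap, 0 <= kap & forall lam, K lam -> `|lam| <= kap.
  have [r [_ Kr]] := compact_bounded K_compact.
  exists (`|r| + 1); first by rewrite addr_ge0.
  by move=> lam Klam; apply: Kr => //; rewrite (le_lt_trans (ler_norm r)) // ltrDl.
pose Mt := 1 + MS + kap * MP + MQ.
have Mt1 : 1 <= Mt by rewrite /Mt -!addrA lerDl !addr_ge0 ?mulr_ge0.
have tM lam n x : K lam -> hnorm (transfer a b lam n x) <= Mt * hnorm x.
  move=> Klam; apply: le_trans (limit_transfer_le bP bq bs _ _ _) _.
  by rewrite ler_wpM2r ?hnorm_ge0 // !lerD // ler_pM ?opnorm_ge0 ?Kkap.
have [KS KS0 SK] := recS_lower_of_coercive ba bb ia N_ge1 a_gt0 c0 Mt1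
  (fun n x => tM lam0 n x Klam0) (fun k => coer lam0 k Klam0).
(* La bounds the ratios of consecutive opnorm (a n), Lw those of the states *)
pose M1 := KS + MP + MQ.
have M10 : 0 <= M1 by rewrite !addr_ge0.
pose Lw := Mt + (1 + M1 * (1 + kap * M1 + M1)).
pose La := 1 + KS * MI + MS.
have La1 : 1 <= La by rewrite /La -!addrA lerDl !addr_ge0 ?mulr_ge0.
have Lw1 : 1 <= Lw.
  by rewrite /Lw (le_trans Mt1) // lerDl !addr_ge0 ?mulr_ge0 ?addr_ge0 ?mulr_ge0.
have La0 : 0 <= La by apply: le_trans La1.
have Lw0 : 0 <= Lw by apply: le_trans Lw1.
have a_up n : opnorm (a n.+1) <= La * opnorm (a n).
  apply: le_trans (opnorm_ratio_up ba ia x0n KS0 (SK n.+1) (IM n.+1)) _ => /=.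
  by rewrite ler_wpM2r ?opnorm_ge0 // /La; lra.
have a_down n : opnorm (a n) <= La * opnorm (a n.+1).
  apply: le_trans (opnorm_ratio_down ba ia (SM n.+1)) _.
  rewrite ler_wpM2r ?opnorm_ge0 // /La lerDr addr_ge0 // mulr_ge0 //.
have w_up lam n x : K lam -> hnorm (transfer a b lam n x) <= Lw * hnorm x.
  move=> Klam; apply: le_trans (tM _ _ _ Klam) _; rewrite ler_wpM2r ?hnorm_ge0 //.
  by rewrite /Lw lerDl !addr_ge0 ?mulr_ge0 ?addr_ge0 ?mulr_ge0.
have w_down lam n x : K lam -> hnorm x <= Lw * hnorm (transfer a b lam n x).
  move=> Klam.
  apply: le_trans (transfer_lower x M10 kap0 _ _ _ (Kkap _ Klam)) _.
  - move=> y; apply: le_trans (le_opnorm y (bP n)) _.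
    by rewrite ler_wpM2r ?hnorm_ge0 // (le_trans (PM n)) // /M1; lra.
  - move=> y; apply: le_trans (le_opnorm y (bq n)) _.
    by rewrite ler_wpM2r ?hnorm_ge0 // (le_trans (QM n)) // /M1; lra.
  - move=> y; apply: le_trans (SK n y) _.
    by rewrite ler_wpM2r ?hnorm_ge0 // /M1; lra.
  - rewrite ler_wpM2r ?hnorm_ge0 // /Lw lerDr (le_trans _ Mt1) //.
have [v1 v2 v3] : [/\ (operator_variation N 0 (recT a) < +oo)%E,
    (operator_variation N 0 (recQ a b) < +oo)%E
    & (operator_variation N 1 (recS a) < +oo)%E].
  have := variation_finite.
  rewrite -/(recT a) -/(recQ a b) -/(recS a).
  have vT := operator_variation_ge0 N 0 bP; have vQ := operator_variation_ge0 N 0 bq.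
  have vS := operator_variation_ge0 N 1 bs.
  move=> fin; split; apply: le_lt_trans fin.
  - by rewrite -addeA leeDl // adde_ge0.
  - by rewrite -addeA addeCA leeDl // adde_ge0.
  - by rewrite leeDr // adde_ge0.
have [D1 hD1] := variation_sums bP v1; have [D2 hD2] := variation_sums bq v2.
have [D3 hD3] := variation_sums bs v3.
have d0 : forall n, 0 <= period_defect a b N n := period_defect_ge0 N ba bb ia.
pose E := Lw ^+ N * La ^+ N * (kap + 1).
have E0 : 0 <= E.
  by rewrite /E mulr_ge0 ?addr_ge0 // mulr_ge0 ?exprn_ge0.
have from1 (f : nat -> R) n : (forall i, 0 <= f i) ->
    \sum_(1 <= i < n) f i <= \sum_(0 <= i < n) f i.
  move=> f0; case: n => [|n]; first by rewrite !big_geq.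
  by rewrite [leRHS]big_nat_recl // big_add1 /= lerDr.
have Ed0 n : 0 <= E * period_defect a b N n by rewrite mulr_ge0.
have EdD n : \sum_(1 <= i < n) E * period_defect a b N i <= E * (D1 + D2 + D3).
  rewrite -mulr_sumr ler_wpM2l // !big_split /=.
  rewrite !lerD // (le_trans (from1 _ _ _)) // => i;
    exact/opnorm_ge0/bounded_operatorB.
pose cl := c / La ^+ N; pose cu := cl + 2 * La ^+ N * Lw ^+ N.
have LaN : 0 < La ^+ N by rewrite exprn_gt0 // (lt_le_trans _ La1).
have cl0 : 0 < cl by rewrite divr_gt0.
have clu : cl <= cu by rewrite /cu lerDl !mulr_ge0 ?exprn_ge0.
have L1 : 1 <= La * Lw ^+ 2 by rewrite mulr_ege1 // exprn_ege1.
have [G G0 compare] := comparable_of_slow_variation (maxn k0 1) N_ge1 L1 cl0 clu Ed0 EdD.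
exists (opnorm (a 1%N) / G), (G * opnorm (a 1%N)).
split; [by rewrite divr_gt0 | by rewrite mulr_gt0 |].
move=> lam u Klam ev n n1.
have zE m : energy a u m = opnorm (a m) * (hnorm (u m.-1) ^+ 2 + hnorm (u m) ^+ 2).
  by rewrite /energy hnorm_dsum.
have st m : (1 <= m)%N -> state u m.+1 = transfer a b lam m (state u m).
  exact: state_recursion.
have u_up m : (1 <= m)%N -> hnorm (state u m.+1) <= Lw * hnorm (state u m).
  by move=> m1; rewrite st ?w_up.
have u_down m : (1 <= m)%N -> hnorm (state u m) <= Lw * hnorm (state u m.+1).
  by move=> m1; rewrite st ?w_down.
have sq (s t : R) (x y : dsum H) : 0 <= s -> 0 <= t -> s <= La * t ->
    hnorm x <= Lw * hnorm y -> s * hnorm x ^+ 2 <= La * Lw ^+ 2 * (t * hnorm y ^+ 2).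
  move=> s0 t0 st' xy.
  have -> : La * Lw ^+ 2 * (t * hnorm y ^+ 2) = (La * t) * (Lw * hnorm y) ^+ 2 by ring.
  by rewrite ler_pM ?exprn_ge0 ?hnorm_ge0 // lerXn2r ?nnegrE ?mulr_ge0 ?hnorm_ge0.
have lamk := Kkap _ Klam.
have [|||||h1 h2] := compare (energy a u) (turan a u N) _ _ _ _ _ n n1.
- by move=> m _; apply: energy_ge0.
- by move=> m m1; apply: sq (u_up _ m1); rewrite ?opnorm_ge0.
- by move=> m m1; apply: sq (u_down _ m1); rewrite ?opnorm_ge0.
- by move=> m m1; exact: (turan_variation N ba bb ia sb La1 Lw1 lamk ev a_up u_up m1).
- move=> k; rewrite geq_max => /andP[k0k k1].
  have m1 : (1 <= k * N)%N by rewrite muln_gt0 k1.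
  rewrite (energy_le_turan ba ia N_ge1 La1 ev) ?(ltW c0) //=; last exact: coer.
  apply: le_trans (turan_le_energy ba N_ge1 La1 Lw1 a_up u_up m1) _.
  by rewrite ler_wpM2r ?energy_ge0 // /cu lerDr ltW.
have z1 : opnorm (a 1%N) * (hnorm (u 0%N) ^+ 2 + hnorm (u 1%N) ^+ 2) = energy a u 1.
  by rewrite zE.
rewrite -zE -(mulrA G) z1 h1 andbT -(mulrA (opnorm _)) (mulrC G^-1) mulrA z1.
by rewrite ler_pdivrMr // mulrC.
Qed.
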